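(* Let $p$ be a prime and $\mathbf V$ a vector space over $\mathbb Z_p$. For each embedding of $L_p^{\mathbf V}$ in a harmonic matroid, the harmonic closure $\mathbf h^\infty(L_p^{\mathbf V})$ is a projective rectangle of order $(p,|\mathbf V|)$ in which every plane is Desarguesian of order $p$.
   Context: In a matroid, points are rank-1 flats (or elements, in a simple matroid) and lines are rank-2 flats; $\mathrm{cl}$ is the closure operator. When $L_p^{\mathbf V}$ is embedded in a matroid $M$, it is identified with its image, a submatroid of $M$. Matroid $L_p^{\mathbf V}$: the simple matroid of rank 3 on $A\cup B\cup C$, where $A=\{a_g: g\in\mathbf V\}\cup\{D\}$, $B=\{b_g: g\in\mathbf V\}\cup\{D\}$, $C=\{c_g: g\in\mathbf V\}\cup\{D\}$ (all points $a_g,b_g,c_g,D$ distinct), defined by the rank-2 flats $A$, $B$, $C$ and $\{a_g,b_{g+h},c_h\}$ with $g,h\in\mathbf V$. Harmonic conjugation: let $d,e,f$ be three points in a matroid $M$ that are collinear in a line $l$. Suppose there are four more points $a_1,a_2,a_3,a_4$ in $M$ such that $\{d,a_1,a_2\}$, $\{d,a_4,a_3\}$, $\{e,a_4,a_2\}$, $\{f,a_4,a_1\}$, $\{f,a_3,a_2\}$ are collinear, while $\{a_1,e,a_3\}$ may or may not be collinear. Then the seven points form a harmonic configuration $\mathrm{HP}(d,e,f;a_1,a_2,a_3,a_4)$ based on $(d,e,f)$. There may be a point $h$ at the intersection of the lines spanned by $\{a_1,a_3\}$ and $\{d,f\}$. If $h$ always exists and is the same point for any harmonic configuration based on $\{d,e,f\}$,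 then $h$ is the harmonic conjugate of $e$ with respect to $d$ and $f$ ($e$ and $h$ need not be distinct). $\mathrm H(d,f;e,h)$ means that there are elements with $\mathrm{HP}(d,e,f;a_1,a_2,a_3,a_4)$ and that $h$ is the harmonic conjugate of $e$ with respect to $d$ and $f$. A matroid is harmonic if a harmonic conjugate exists for every harmonic configuration in it. For a set $S$ of points of a harmonic matroid $M$, $\mathbf h(S)=S\cup\{x\in M:\mathrm H(a,c;b,x)\text{ for some }a,b,c\in S\}$ and the harmonic closure is $\mathbf h^\infty(S)=\bigcup_{k\ge0}\mathbf h^k(S)$. The set $\mathbf h^\infty(S)$ is regarded as an incidence structure whose lines are the sets $\mathrm{cl}\{x,y\}\cap\mathbf h^\infty(S)$ for distinct $x,y\in\mathbf h^\infty(S)$. Projective rectangle: an incidence structure of points and lines such that (A1) every two distinct points are incident with exactly one line; (A2) there exist four points with no three of them collinear; (A3) every line is incident with at least three distinct points; (A4) there is a special point $D$; a line incident with $D$ is special, a line not incident with $D$ is ordinary, and a point other than $D$ is ordinary; (A5) each special line intersects every other line in exactly one point; (A6) if two ordinary lines $l_1,l_2$ intersect in a point, then every two lines that intersect both $l_1$ and $l_2$ in four distinct points intersect in a point. It has order $(m,n)$ if it has exactly $m+1$ special lines and one of them has $n+1$ points ($m,n$ may be infinite). A plane in a projective rectangle is a full projective subplane: an incidence substructure (subsets of the points and of the lines, with restricted incidence) that is a projective plane and contains an ordinary line and all its points.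
   Formalization: V is assumed nonzero, and in h(S) the points a1,...,a4 of the harmonic configuration giving a new point must lie in S rather than anywhere in M; the claim fails for V = 0 and, with configurations anywhere in M, for some V of dimension at least 2. *)

(* Defs.v *)
(* MathComp, with classical sets and cardinality from MathComp-Analysis. *)
From Stdlib Require List.
From mathcomp Require Import all_boot all_order all_algebra.
From mathcomp Require Import all_classical.

Set Implicit Arguments.
Unset Strict Implicit.
Unset Printing Implicit Defensive.

Import GRing.Theory.
Local Open Scope classical_set_scope.

(* Finitary matroids on an arbitrary, possibly infinite, ground set; this
   includes every matroid of finite rank. *)
Record matroid (E : Type) := Matroid {
  cl : set E -> set E;
  cl_extensive : forall S, S `<=` cl S;
  cl_monotone : forall S S', S `<=` S' -> cl S `<=` cl S';
  cl_idempotent : forall S, cl (cl S) `<=` cl S;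
  cl_exchange : forall S x y, cl (x |` S) y -> ~ cl S y -> cl (y |` S) x;
  cl_finitary : forall S x, cl S x ->
    exists S', [/\ finite_set S', S' `<=` S & cl S' x]
}.

Definition rank1_flat (E : Type) (M : matroid E) (F : set E) : Prop :=
  exists x, ~ cl M set0 x /\ F = cl M [set x].

Definition mline (E : Type) (M : matroid E) (F : set E) : Prop :=
  exists x y, [/\ ~ cl M set0 x, ~ cl M [set x] y & F = cl M [set x; y]].

(* M is not assumed simple, so its points are its rank-1 flats rather than its
   elements. *)
Definition mpoint (E : Type) (M : matroid E) : Type :=
  {F : set E | rank1_flat M F}.

Definition pset (E : Type) (M : matroid E) (x : mpoint M) : set E := sval x.

Definition span2 (E : Type) (M : matroid E) (x y : mpoint M) : set E :=
  cl M (pset x `|` pset y).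

Definition collinear (E : Type) (M : matroid E) (s : seq (mpoint M)) : Prop :=
  exists2 l, mline M l & forall x, List.In x s -> pset x `<=` l.

(* The embedding phi is an isomorphism of N onto the restriction of M to the
   range of phi. *)
Definition matroid_embedding (E' E : Type) (N : matroid E') (M : matroid E)
    (phi : E' -> E) : Prop :=
  injective phi /\
  forall (S : set E') (x : E'), cl M (phi @` S) (phi x) <-> cl N S x.

(* Given the listed collinear triples, seven distinct points that are not all
   on one line have no other collinear triple than possibly {a1, e, a3}: they
   form a Fano or a non-Fano matroid. *)
Definition HP (E : Type) (M : matroid E) (d e f a1 a2 a3 a4 : mpoint M) : Prop :=
  List.NoDup [:: d; e; f; a1; a2; a3; a4] /\
  ~ collinear [:: d; e; f; a1; a2; a3; a4] /\
  [/\ collinear [:: d; e; f],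
      collinear [:: d; a1; a2] /\ collinear [:: d; a4; a3],
      collinear [:: e; a4; a2]
    & collinear [:: f; a4; a1] /\ collinear [:: f; a3; a2]].

(* h is the harmonic conjugate of e with respect to d and f.  The lines
   spanned by {a1, a3} and {d, f} are distinct, so h is unique as soon as there
   is a harmonic configuration based on (d, e, f). *)
Definition harmonic_conjugate (E : Type) (M : matroid E)
    (d f e h : mpoint M) : Prop :=
  forall a1 a2 a3 a4, HP d e f a1 a2 a3 a4 ->
    pset h `<=` span2 a1 a3 /\ pset h `<=` span2 d f.

Definition harmonic_matroid (E : Type) (M : matroid E) : Prop :=
  forall d e f a1 a2 a3 a4 : mpoint M, HP d e f a1 a2 a3 a4 ->
    exists h, harmonic_conjugate d f e h.

(* H(d, f; e, h), where the elements witnessing the harmonic configuration are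
   taken in X.  That h is the conjugate still refers to all the harmonic
   configurations of M. *)
Definition harmonic_in (E : Type) (M : matroid E) (X : set (mpoint M))
    (d f e h : mpoint M) : Prop :=
  (exists a1 a2 a3 a4, [/\ X a1, X a2, X a3 & X a4] /\ HP d e f a1 a2 a3 a4) /\
  harmonic_conjugate d f e h.

(* The witnesses of the harmonic configurations are taken in S, not anywhere in
   M: otherwise the closure of L_p^V is too large when dim V > 1.  For example,
   let p = 3, let V be spanned by 1 and t in K = GF(27), t not in GF(3), and let
   M be the projective plane over K.  Put a_g = (0, g), c_h = (1, - h), b_k the
   point at infinity of slope - k and D the vertical one.  The harmonic
   conjugate in M of a_0 with respect to a_1 and a_t is (0, 2t / (1 + t)), on the
   special line A, and 2t / (1 + t) is not in V. *)
Definition harmonic_step (E : Type) (M : matroid E) (S : set (mpoint M)) :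
    set (mpoint M) :=
  S `|` [set x | exists a b c, [/\ S a, S b & S c] /\ harmonic_in S a c b x].

Definition harmonic_closure (E : Type) (M : matroid E) (S : set (mpoint M)) :
    set (mpoint M) :=
  \bigcup_k iter k (@harmonic_step E M) S.

Record incidence := Incidence {
  ipoint : Type;
  iline : Type;
  inc : ipoint -> iline -> Prop
}.

Definition subincidence (I : incidence) (P : set (ipoint I)) (L : set (iline I)) :
    incidence :=
  @Incidence {x | P x} {l | L l} (fun x l => inc (sval x) (sval l)).

Definition icollinear (I : incidence) (x y z : ipoint I) : Prop :=
  exists l : iline I, [/\ inc x l, inc y l & inc z l].

Definition unique_line (I : incidence) : Prop :=
  forall x y : ipoint I, x <> y -> exists! l : iline I, inc x l /\ inc y l.

Definition has_quadrangle (I : incidence) : Prop :=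
  exists x y z t : ipoint I,
    [/\ List.NoDup [:: x; y; z; t], ~ icollinear x y z, ~ icollinear x y t,
        ~ icollinear x z t & ~ icollinear y z t].

Definition lines_have_3_points (I : incidence) : Prop :=
  forall l : iline I, exists x y z : ipoint I,
    List.NoDup [:: x; y; z] /\ [/\ inc x l, inc y l & inc z l].

Definition special_meets_all (I : incidence) (D : ipoint I) : Prop :=
  forall l l' : iline I, inc D l -> l <> l' ->
    exists! x, inc x l /\ inc x l'.

Definition four_point_axiom (I : incidence) (D : ipoint I) : Prop :=
  forall l1 l2 : iline I, ~ inc D l1 -> ~ inc D l2 -> l1 <> l2 ->
    (exists x, inc x l1 /\ inc x l2) ->
  forall l3 l4 : iline I, l3 <> l4 ->
    (exists x13 x23 x14 x24 : ipoint I,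
      [/\ List.NoDup [:: x13; x23; x14; x24],
          inc x13 l1 /\ inc x13 l3, inc x23 l2 /\ inc x23 l3,
          inc x14 l1 /\ inc x14 l4 & inc x24 l2 /\ inc x24 l4]) ->
    exists x, inc x l3 /\ inc x l4.

Definition projective_rectangle (I : incidence) (D : ipoint I) : Prop :=
  unique_line I /\
  [/\ has_quadrangle I, lines_have_3_points I, special_meets_all D
    & four_point_axiom D].

Local Open Scope card_scope.

(* Order (|m|, |n|), for types m and n: [option m] has |m| + 1 elements. *)
Definition rectangle_order (I : incidence) (D : ipoint I) (m n : Type) : Prop :=
  [set l : iline I | inc D l] #= [set: option m] /\
  exists l : iline I, inc D l /\ [set x | inc x l] #= [set: option n].

Definition projective_plane (I : incidence) : Prop :=
  [/\ unique_line I,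
      forall l l' : iline I, l <> l' -> exists! x, inc x l /\ inc x l'
    & has_quadrangle I].

Definition plane_order (I : incidence) (n : nat) : Prop :=
  forall l : iline I, [set x | inc x l] #= `I_n.+1.

(* Two triangles in perspective from a point O are in perspective from a line.
   The hypotheses force corresponding sides to be distinct, so x, y and z are
   their intersection points. *)
Definition desarguesian (I : incidence) : Prop :=
  forall (O a1 b1 c1 a2 b2 c2 : ipoint I) (la lb lc : iline I),
    [/\ inc O la, inc O lb & inc O lc] ->
    [/\ la <> lb, lb <> lc & la <> lc] ->
    List.NoDup [:: O; a1; a2] -> List.NoDup [:: O; b1; b2] ->
    List.NoDup [:: O; c1; c2] ->
    inc a1 la /\ inc a2 la -> inc b1 lb /\ inc b2 lb ->
    inc c1 lc /\ inc c2 lc ->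
    ~ icollinear a1 b1 c1 -> ~ icollinear a2 b2 c2 ->
  forall (ab1 ab2 bc1 bc2 ca1 ca2 : iline I) (x y z : ipoint I),
    inc a1 ab1 /\ inc b1 ab1 -> inc a2 ab2 /\ inc b2 ab2 ->
    inc b1 bc1 /\ inc c1 bc1 -> inc b2 bc2 /\ inc c2 bc2 ->
    inc c1 ca1 /\ inc a1 ca1 -> inc c2 ca2 /\ inc a2 ca2 ->
    inc x ab1 /\ inc x ab2 -> inc y bc1 /\ inc y bc2 ->
    inc z ca1 /\ inc z ca2 ->
    icollinear x y z.

(* (P, L) is a full projective subplane of the projective rectangle I with
   special point D. *)
Definition rectangle_plane (I : incidence) (D : ipoint I)
    (P : set (ipoint I)) (L : set (iline I)) : Prop :=
  projective_plane (subincidence P L) /\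
  exists l : iline I, [/\ L l, ~ inc D l & forall x, inc x l -> P x].

Definition set_incidence (E : Type) (M : matroid E) (X : set (mpoint M)) :
    incidence :=
  @Incidence {x | X x}
    {l : set (mpoint M) | exists x y, [/\ X x, X y, x <> y &
       l = [set z | X z /\ pset z `<=` span2 x y]]}
    (fun x l => sval l (sval x)).

(* The matroid of rank at most 3 whose flats are the empty set, the singletons,
   the given lines and the whole set. *)
Definition unique_set_line (T : Type) (lines : set (set T)) : Prop :=
  forall x y, x <> y -> exists! l, lines l /\ l x /\ l y.

Definition planar_flat (T : Type) (lines : set (set T)) (F : set T) : Prop :=
  [\/ F = set0, exists x, F = [set x], lines F | F = setT].

Definition planar_cl (T : Type) (lines : set (set T)) (S : set T) : set T :=
  [set x | forall F, planar_flat lines F -> S `<=` F -> F x].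

Lemma planar_cl_ext (T : Type) (lines : set (set T)) S :
  S `<=` planar_cl lines S.
Proof. by move=> x Sx F _; apply. Qed.

Lemma planar_cl_mono (T : Type) (lines : set (set T)) S S' :
  S `<=` S' -> planar_cl lines S `<=` planar_cl lines S'.
Proof. by move=> SS' x + F Ff S'F; apply=> // y /SS' /S'F. Qed.

Lemma planar_cl_idem (T : Type) (lines : set (set T)) S :
  planar_cl lines (planar_cl lines S) `<=` planar_cl lines S.
Proof. by move=> x + F Ff SF; apply=> // y; apply. Qed.

Lemma planar_cl_exch (T : Type) (lines : set (set T)) :
  unique_set_line lines -> forall S x y,
  planar_cl lines (x |` S) y -> ~ planar_cl lines S y ->
  planar_cl lines (y |` S) x.
Proof.
move=> ul S x y yxS yS F Ff ySF; apply: contrapT => nFx; apply: yS => G Gf SG.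
have Fy : F y by apply: ySF; left.
have SF : S `<=` F by move=> z Sz; apply: ySF; right.
apply: contrapT => nGy.
have key : forall z, S `<=` [set z] -> z <> y -> F z -> False.
  move=> z Sz zy Fz.
  have xz : x <> z by move=> xz; apply: nFx; rewrite xz.
  have [l [[ll [lx lz]] _]] := ul x z xz.
  have ly : l y.
    apply: (yxS l); first by apply: Or43.
    by move=> t [->//|/Sz ->].
  case: Ff => [F0|[w Fw]|Fl|FT].
  - by move: Fy; rewrite F0.
  - by move: Fy Fz zy; rewrite Fw => -> ->.
  - have [m [_ mu]] := ul z y zy.
    apply: nFx; suff -> : F = l by [].
    by rewrite -(mu F) ?(mu l).
  - by apply: nFx; rewrite FT.
have S0 : S `<=` set0 -> False.
  move=> S0; have yx : y = x.
    apply: (yxS [set x]); first by apply: Or42; exists x.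
    by move=> t [//|/S0].
  by apply: nFx; rewrite -yx.
case: (pselect (exists z, S z)) => [[z Sz]|nS]; last first.
  by apply: S0 => t St; apply: nS; exists t.
have zy : z <> y by move=> zy; apply: nGy; rewrite -zy; apply: SG.
apply: (key z) => //; last exact: SF.
move=> t St; apply: contrapT => /= tz.
case: Ff => [F0|[w Fw]|Fl|FT].
- by move: Fy; rewrite F0.
- by move: (SF _ Sz) Fy zy; rewrite Fw => -> ->.
- case: Gf => [G0|[w Gw]|Gl|GT].
  + by move: (SG _ Sz); rewrite G0.
  + by move: (SG _ Sz) (SG _ St) tz; rewrite Gw => -> ->.
  + have [m [_ mu]] := ul t z tz.
    apply: nGy; suff -> : G = F by [].
    have [? ?] := (SG _ Sz, SG _ St); have [? ?] := (SF _ Sz, SF _ St).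
    by rewrite -(mu F) ?(mu G).
  + by apply: nGy; rewrite GT.
- by apply: nFx; rewrite FT.
Qed.

Lemma planar_cl_fin (T : Type) (lines : set (set T)) :
  unique_set_line lines -> forall S x, planar_cl lines S x ->
  exists S', [/\ finite_set S', S' `<=` S & planar_cl lines S' x].
Proof.
move=> ul S x xS.
case: (pselect (exists a, S a)) => [[a Sa]|nS]; last first.
  exists set0; split=> //; apply: planar_cl_mono xS => t St.
  by case: nS; exists t.
case: (pselect (exists2 b, S b & b <> a)) => [[b Sb ba]|nS]; last first.
  exists [set a]; split=> //; first by move=> t ->.
  apply: planar_cl_mono xS => t St /=.
  by apply: contrapT => ta; apply: nS; exists t.
have [l [[ll [lb la]] lu]] := ul b a ba.
have ab : forall F, planar_flat lines F -> F a -> F b -> F = l \/ F = setT.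
  move=> F [->//|[w ->] /= wa wb|Fl Fa Fb|->]; last by right.
  - by case: ba; rewrite wa wb.
  - by left; rewrite (lu F).
case: (pselect (exists2 c, S c & ~ l c)) => [[c Sc lc]|nS].
  exists [set a; b; c]; split.
  - by rewrite !finite_setU; split; [split|]; apply: finite_set1.
  - by move=> t [[->|->]|->].
  - move=> F Ff sF; case: (ab F Ff) => [||Fl|-> //].
    + by apply: sF; left; left.
    + by apply: sF; left; right.
    + by case: lc; rewrite -Fl; apply: sF; right.
exists [set a; b]; split.
- by rewrite finite_setU; split; apply: finite_set1.
- by move=> t [->|->].
- move=> F Ff sF; case: (ab F Ff) => [||Fl|-> //].
  + by apply: sF; left.
  + by apply: sF; right.
  + apply: (xS F Ff) => t St; rewrite Fl.
    by apply: contrapT => nlt; apply: nS; exists t.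
Qed.

Definition planar_matroid (T : Type) (lines : set (set T))
    (ul : unique_set_line lines) : matroid T :=
  @Matroid T (planar_cl lines) (@planar_cl_ext T lines)
    (@planar_cl_mono T lines) (@planar_cl_idem T lines) (planar_cl_exch ul)
    (planar_cl_fin ul).

Inductive Lpoint (V : Type) : Type :=
  | La of V
  | Lb of V
  | Lc of V
  | LD.
Arguments LD {V}.

Definition Lline (V : zmodType) (l : set (Lpoint V)) : Prop :=
  [\/ l = range (@La V) `|` [set LD],
      l = range (@Lb V) `|` [set LD],
      l = range (@Lc V) `|` [set LD]
    | exists g h : V, l = [set La g; Lb (g + h)%R; Lc h]].

Lemma Lline_unique (V : zmodType) : unique_set_line (@Lline V).
Proof.
move=> x y xy.
have exl : exists l, Lline l /\ l x /\ l y.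
  pose lA := range (@La V) `|` [set LD]; pose lB := range (@Lb V) `|` [set LD].
  pose lC := range (@Lc V) `|` [set LD].
  pose lT g h := [set La g; Lb (g + h)%R; Lc h] : set (Lpoint V).
  have [hA hB hC] : [/\ Lline lA, Lline lB & Lline lC].
    by split; [exact: Or41|exact: Or42|exact: Or43].
  have hT g h : Lline (lT g h) by apply: Or44; exists g, h.
  have [AD BD CD] : [/\ lA LD, lB LD & lC LD] by split; right.
  have Aa g : lA (La g) by left; exists g.
  have Bb g : lB (Lb g) by left; exists g.
  have Cc g : lC (Lc g) by left; exists g.
  have Ta g h : lT g h (La g) by left; left.
  have Tb g h : lT g h (Lb (g + h)%R) by left; right.
  have Tc g h : lT g h (Lc h) by right.
  have Tba g k : lT g (k - g)%R (Lb k).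
    by left; right => /=; rewrite addrC subrK.
  have Tbc h k : lT (k - h)%R h (Lb k) by left; right => /=; rewrite subrK.
  case: x y xy => [g|g|g|] [h|h|h|] xy; first [
    by exists lA | by exists lB | by exists lC | by case: xy
  | by exists (lT g (h - g)%R) | by exists (lT h (g - h)%R)
  | by exists (lT g h) | by exists (lT h g)
  | by exists (lT (h - g)%R g) | by exists (lT (g - h)%R h)].
have [l [ll [lx ly]]] := exl.
exists l; split=> // l' [ll' [lx' ly']].
case: ll lx ly => [->|->|->|[g [h ->]]];
case: ll' lx' ly' => [->|->|->|[g' [h' ->]]];
rewrite /setU /= => Hx' Hy' Hx Hy //;
repeat match goal with
| H : _ \/ _ |- _ => destruct H
| H : exists2 _, _ & _ |- _ => destruct H
end; subst; try congruence.
all: repeat match goal with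
| H : La _ = La _ |- _ => case: H => H; subst
| H : Lb _ = Lb _ |- _ => case: H => H; subst
| H : Lc _ = Lc _ |- _ => case: H => H; subst
end; try by [].
all: match goal with
| H : (_ + _)%R = (_ + _)%R |- _ =>
    first [move/addrI: H => -> // | move/addIr: H => -> //]
end.
Qed.

Definition LpV (V : zmodType) : matroid (Lpoint V) :=
  planar_matroid (@Lline_unique V).

Lemma LpV_simple (V : zmodType) :
  cl (LpV V) set0 = set0 /\ forall x, cl (LpV V) [set x] = [set x].
Proof.
split=> [|x]; apply/seteqP; split=> y.
- by move/(_ set0); apply=> //; apply: Or41.
- by [].
- by move/(_ [set x]); apply=> //; apply: Or42; exists x.
- exact: cl_extensive.
Qed.

Lemma LpV_cl2 (V : zmodType) (x y : Lpoint V) (l : set (Lpoint V)) :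
  x <> y -> Lline l -> l x -> l y -> cl (LpV V) [set x; y] = l.
Proof.
move=> xy ll lx ly; apply/seteqP; split=> z.
  by move/(_ l); apply; [apply: Or43|move=> t [->|->]].
move=> lz F [F0|[w Fw]|Fl|FT] sF.
- by have := sF x (or_introl erefl); rewrite F0.
- have := sF x (or_introl erefl); have := sF y (or_intror erefl).
  by rewrite Fw => /= yw xw; case: xy; rewrite yw.
- have [m [_ mu]] := Lline_unique xy.
  have [? ?] := (sF x (or_introl erefl), sF y (or_intror erefl)).
  suff -> : F = l by [].
  by rewrite -(mu F) ?(mu l).
- by rewrite FT.
Qed.

Lemma LpV_mline (V : zmodType) : mline (LpV V) = @Lline V.
Proof.
have [c0 c1] := LpV_simple V.
apply/funext => l; apply/propext; split.
  move=> [x [y [_ xy ->]]].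
  have {}xy : x <> y by move=> xy'; apply: xy; rewrite c1 xy'.
  have [m [[ml [mx my]] _]] := Lline_unique xy.
  by rewrite (LpV_cl2 xy ml mx my).
move=> ll.
have [x [y [xy lx ly]]] : exists x y, [/\ x <> y, l x & l y].
  case: ll => [->|->|->|[g [h ->]]].
  - by exists (La 0%R), LD; split=> //; [left; exists 0%R|right].
  - by exists (Lb 0%R), LD; split=> //; [left; exists 0%R|right].
  - by exists (Lc 0%R), LD; split=> //; [left; exists 0%R|right].
  - by exists (La g), (Lc h); split=> //; [left; left|right].
exists x, y; rewrite c0 c1 (LpV_cl2 xy ll lx ly); split=> //= yx.
by apply: xy; rewrite yx.
Qed.

Lemma LpV_rank3 (V : zmodType) :
  cl (LpV V) [set La 0%R; Lb 0%R; LD] = setT /\ ~ Lline [set: Lpoint V].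
Proof.
have nl (F : set (Lpoint V)) : Lline F -> F (La 0%R) -> F (Lb 0%R) -> ~ F LD.
  case=> [->|->|->|[g [h ->]]]; rewrite /setU /= => Ha Hb HD;
  repeat match goal with
  | H : _ \/ _ |- _ => destruct H
  | H : exists2 _, _ & _ |- _ => destruct H
  end; congruence.
split; last by move=> /nl; apply.
apply/seteqP; split=> // x _ F Ff sF.
have Fa : F (La 0%R) by apply: sF; left; left.
have Fb : F (Lb 0%R) by apply: sF; left; right.
have FD : F LD by apply: sF; right.
case: Ff => [F0|[w Fw]|/nl nF|-> //].
- by move: Fa; rewrite F0.
- by move: Fa Fb; rewrite Fw => /= <-.
- by case: nF.
Qed.

Definition embedded_points (V E : Type) (M : matroid E) (phi : Lpoint V -> E) :
    set (mpoint M) :=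
  [set x | exists u, pset x = cl M [set phi u]].
Arguments embedded_points {V E} M phi.

(* Main.v *)
Require Import Defs.
From mathcomp Require Import all_boot all_order all_algebra.
From mathcomp Require Import all_classical.
From mathcomp Require Import ring.

(* Write V-valued coordinates as follows: a_g = (0, g), c_h = (1, - h), b_k is the
   point at infinity of slope - k and D that of the vertical lines.  The ordinary
   lines of L_p^V then read y = m x + c with m, c in V.  If the points with
   abscissas x and x + 1 are known, the harmonic conjugate of (x, y) with respect
   to (x + 1, y) and b_0 lies on all lines through (x + 2, y), because each such
   line occurs as the line a1 a3 of a harmonic configuration with a2 = D; a second
   configuration, with a1 = D, shows that the points of abscissa x + 2 are
   collinear with D.  A point is determined by the pencil of ordinary lines through
   it, so x only matters modulo p, and one obtains (p + 1) |V| + 1 points whose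
   incidences are those of an explicit rectangle.  The four point axiom of this
   rectangle shows that it is closed under harmonic conjugation.

   A full plane contains an ordinary line l0, which may be subtracted from all
   ordinates; the remaining ordinates of its points are then all proportional to one
   vector v, so that the plane has homogeneous coordinates in F_p^3. *)

Set Implicit Arguments.
Unset Strict Implicit.
Unset Printing Implicit Defensive.

Import GRing.Theory.
Local Open Scope classical_set_scope.
Local Open Scope ring_scope.
Local Open Scope card_scope.

(** * The explicit rectangle over a vector space *)

Section RectangleModel.

Variables (F : fieldType) (V : lmodType F).

(* [RP (Some x) y] is the affine point (x, y), [RP None m] is the point at
   infinity of slope m and [RD] is the point at infinity of the vertical lines;
   [RO m c] is the line y = m x + c. *)
Inductive rpoint := RD | RP of option F & V.
Inductive rline := RS of option F | RO of V & V.

Definition ev (i : option F) (m c : V) : V := if i is Some x then x *: m + c else m.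

Definition rinc (q : rpoint) (l : rline) : Prop :=
  match q, l with
  | RD, RS _ => True
  | RD, RO _ _ => False
  | RP i y, RS j => i = j
  | RP i y, RO m c => y = ev i m c
  end.

Definition on_axis (v y : V) : Prop := exists s : F, y = s *: v.

Lemma on_axisD v y z : on_axis v y -> on_axis v z -> on_axis v (y + z).
Proof. by move=> [s ->] [t ->]; exists (s + t); rewrite scalerDl. Qed.

Lemma on_axisN v y : on_axis v y -> on_axis v (- y).
Proof. by move=> [s ->]; exists (- s); rewrite scaleNr. Qed.

Lemma on_axisZ v a y : on_axis v y -> on_axis v (a *: y).
Proof. by move=> [s ->]; exists (a * s); rewrite scalerA. Qed.

Lemma on_axisB v y z : on_axis v y -> on_axis v z -> on_axis v (y - z).
Proof. by move=> hy hz; apply: on_axisD => //; apply: on_axisN. Qed.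

Lemma on_axis0 v : on_axis v 0.
Proof. by exists 0; rewrite scale0r. Qed.

Lemma on_axis_sym v y : y <> 0 -> on_axis v y -> on_axis y v.
Proof.
move=> y0 [s e]; have s0 : s != 0.
  by apply/eqP => s0; apply: y0; rewrite e s0 scale0r.
by exists s^-1; rewrite e scalerA mulVf // scale1r.
Qed.

Lemma on_axis_trans v w y : on_axis v w -> on_axis w y -> on_axis v y.
Proof. by move=> vw [s ->]; apply: on_axisZ. Qed.

Lemma evB i m c m' c' : ev i (m - m') (c - c') = ev i m c - ev i m' c'.
Proof. by case: i => [x|] //=; rewrite scalerBr opprD addrACA. Qed.

Lemma ev_on_axis v i m c : on_axis v m -> on_axis v c -> on_axis v (ev i m c).
Proof. by case: i => //= x hm hc; apply: on_axisD => //; apply: on_axisZ. Qed.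

(** Interpolation at two indices recovers the line linearly from its values; hence equality of lines
    and proportionality to a vector can both be tested at two indices. *)
Lemma ev_two i j m c : i <> j ->
  exists a b a' b', m = a *: ev i m c + b *: ev j m c /\
                    c = a' *: ev i m c + b' *: ev j m c.
Proof.
case: i j => [x|] [y|] ij //=.
- have xy : x - y != 0.
    by apply/eqP => /subr0_eq xy; apply: ij; rewrite xy.
  exists (x - y)^-1, (- (x - y)^-1), (- (y / (x - y))), (x / (x - y)).
  rewrite !scalerDr !scalerA; split.
    rewrite addrACA -!scalerDl subrr.
    have -> : (x - y)^-1 * x + - (x - y)^-1 * y = 1 by field.
    by rewrite scale0r scale1r addr0.
  rewrite addrACA -!scalerDl.
  have -> : - (y / (x - y)) * x + x / (x - y) * y = 0 by ring.
  have -> : - (y / (x - y)) + x / (x - y) = 1 by field.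
  by rewrite scale0r scale1r add0r.
- exists 0, 1, 1, (- x); rewrite !(scale1r, scale0r) add0r; split=> //.
  by rewrite scaleNr addrC addrA addNr add0r.
- exists 1, 0, (- y), 1; rewrite !(scale1r, scale0r) addr0; split=> //.
  by rewrite scaleNr addrA addNr add0r.
Qed.

Lemma ev_inj i j m c m' c' : i <> j -> ev i m c = ev i m' c' ->
  ev j m c = ev j m' c' -> m = m' /\ c = c'.
Proof.
move=> ij ei ej.
have [a [b [a' [b' [em ec]]]]] := ev_two (m - m') (c - c') ij.
move: em ec; rewrite !evB ei ej !subrr !scaler0 !addr0.
by move=> /subr0_eq -> /subr0_eq ->.
Qed.

Lemma on_axis_ev v i j m c : i <> j ->
  on_axis v (ev i m c) -> on_axis v (ev j m c) -> on_axis v m /\ on_axis v c.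
Proof.
move=> ij hi hj; have [a [b [a' [b' [em ec]]]]] := ev_two m c ij.
by split; [rewrite em|rewrite ec]; apply: on_axisD; apply: on_axisZ.
Qed.

Lemma ev_interp i j y z : i <> j -> exists m c, ev i m c = y /\ ev j m c = z.
Proof.
case: i j => [s|] [t|] ij //=.
- have st : s - t != 0 by apply/eqP => /subr0_eq st; apply: ij; rewrite st.
  exists ((s - t)^-1 *: (y - z)), (y - (s / (s - t)) *: (y - z)).
  split; rewrite scalerA; first by rewrite addrC subrK.
  rewrite addrCA -scalerBl.
  have -> : t / (s - t) - s / (s - t) = -1 by field.
  by rewrite scaleN1r opprB addrC subrK.
- by exists z, (y - s *: z); rewrite addrC subrK.
- by exists y, (z - t *: y); split=> //; rewrite addrC subrK.
Qed.

(** Applied to the difference of two ordinary lines, this and [axis_ev0] say that the lines meet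
    exactly when the differences of their slopes and of their intercepts are multiples of one
    vector. *)
Lemma ev0_axis i m c : ev i m c = 0 ->
  exists v, on_axis v m /\ on_axis v c.
Proof.
case: i => [x /= e|/= ->].
  exists m; split; first by exists 1; rewrite scale1r.
  by exists (- x); rewrite scaleNr; apply/eqP; rewrite -addr_eq0 addrC e.
by exists c; split; [exact: on_axis0|exists 1; rewrite scale1r].
Qed.

Lemma axis_ev0 v m c : on_axis v m -> on_axis v c -> exists i, ev i m c = 0.
Proof.
move=> [s ->] [t ->]; have [->|s0] := eqVneq s 0.
  by exists None; rewrite /= scale0r.
exists (Some (- t / s)) => /=.
by rewrite scalerA -scalerDl mulrVK ?unitfE // addNr scale0r.
Qed.

Lemma rinc_same (q q' : rpoint) (l l' : rline) : q <> q' ->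
  rinc q l -> rinc q' l -> rinc q l' -> rinc q' l' -> l = l'.
Proof.
case: q q' => [|i y] [|j z] // qq; case: l => [k|m c]; case: l' => [k'|m' c'] //=.
- by move=> _ -> _ ->.
- by move=> -> _ -> _.
- by move=> -> _ ->.
- by move=> e1 e2 e3 e4; case: qq; rewrite e3 e4 e1 e2.
- by move=> e1 e2 e3 e4; case: qq; rewrite e1 e2 e3 e4.
- move=> ei ej ei' ej'; suff [-> ->] : m = m' /\ c = c' by [].
  have ij : i <> j by move=> ij; apply: qq; rewrite ei ej ij.
  by apply: (ev_inj ij); rewrite -?ei -?ej.
Qed.

Lemma rline_through (q q' : rpoint) : q <> q' -> exists l, rinc q l /\ rinc q' l.
Proof.
case: q q' => [|i y] [|j z] // qq; first by exists (RS j).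
  by exists (RS i).
have [->|/eqP ij] := eqVneq i j; first by exists (RS j).
by have [m [c [<- <-]]] := ev_interp y z ij; exists (RO m c).
Qed.

Lemma special_meets i l : RS i <> l -> exists q, rinc q (RS i) /\ rinc q l.
Proof.
case: l => [j|m c] _; first by exists RD.
by exists (RP i (ev i m c)).
Qed.

Lemma rinc_index i y j z m c : RP i y <> RP j z ->
  rinc (RP i y) (RO m c) -> rinc (RP j z) (RO m c) -> i <> j.
Proof. by move=> + /= yE zE ij; apply; rewrite yE zE ij. Qed.

(** The difference from the first line vanishes at [q] and is a multiple of [v] at [q']. The two
    points have different indices, so these two values decide. *)
Lemma transversal_axis v m1 c1 m2 c2 m3 c3 q q' :
  on_axis v (m1 - m2) -> on_axis v (c1 - c2) -> q <> q' ->
  rinc q (RO m1 c1) -> rinc q' (RO m2 c2) ->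
  rinc q (RO m3 c3) -> rinc q' (RO m3 c3) ->
  on_axis v (m3 - m1) /\ on_axis v (c3 - c1).
Proof.
case: q q' => [|i y] [|j z] // hm hc qq q1 q2 q3 q3'.
apply: (on_axis_ev (rinc_index qq q3 q3')).
  by rewrite evB -q3 -q1 subrr; apply: on_axis0.
have -> : ev j (m3 - m1) (c3 - c1) = - ev j (m1 - m2) (c1 - c2).
  by rewrite !evB -q3' -q2 opprB.
by apply: on_axisN; apply: ev_on_axis.
Qed.

(** Two ordinary lines that meet differ by multiples of some [v]. Ordinary transversals differ from
    the first line by multiples of [v] too, hence also from each other, and their difference
    vanishes at some index. A special line meets every other line. *)
Lemma rectangle_four m1 c1 m2 c2 l3 l4 q12 q13 q23 q14 q24 :
  rinc q12 (RO m1 c1) -> rinc q12 (RO m2 c2) -> l3 <> l4 ->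
  q13 <> q23 -> q14 <> q24 ->
  rinc q13 (RO m1 c1) -> rinc q13 l3 -> rinc q23 (RO m2 c2) -> rinc q23 l3 ->
  rinc q14 (RO m1 c1) -> rinc q14 l4 -> rinc q24 (RO m2 c2) -> rinc q24 l4 ->
  exists q, rinc q l3 /\ rinc q l4.
Proof.
case: q12 => [|i y] // i1 i2 l34 n3 n4 h1 h2 h3 h4 h5 h6 h7 h8.
have [v [vm vc]] : exists v, on_axis v (m1 - m2) /\ on_axis v (c1 - c2).
  by apply: (@ev0_axis i); rewrite evB -i1 -i2 subrr.
case: l3 l4 l34 h2 h4 h6 h8 => [j|m3 c3] [k|m4 c4] l34 h2 h4 h6 h8.
- exact: special_meets.
- exact: special_meets.
- by have [q [? ?]] := special_meets (nesym l34); exists q.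
have [am3 ac3] := transversal_axis vm vc n3 h1 h3 h2 h4.
have [am4 ac4] := transversal_axis vm vc n4 h5 h7 h6 h8.
have [j ej] : exists j, ev j (m3 - m4) (c3 - c4) = 0.
  apply: (@axis_ev0 v).
    by rewrite -[m3](subrK m1) -addrA -(opprB m4); apply: on_axisB.
  by rewrite -[c3](subrK c1) -addrA -(opprB c4); apply: on_axisB.
exists (RP j (ev j m3 c3)); split=> //=.
by apply/eqP; rewrite -subr_eq0 -evB ej.
Qed.

(* The conclusion is immediate if one of the two lines is special.  Otherwise
   neither d, f, a1 nor a3 is the special point, hence the lines d a1 a2 and
   f a3 a2, or else the lines d a4 a3 and f a4 a1, are both ordinary, and the
   four point property applies to them. *)
Lemma rectangle_harmonic d f a1 a2 a3 a4 ldf l13 l1 l2 l3 l4 :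
  ldf <> l13 -> d <> f -> a1 <> a3 ->
  rinc d ldf -> rinc f ldf -> rinc a1 l13 -> rinc a3 l13 ->
  rinc d l1 -> rinc a1 l1 -> rinc a2 l1 ->
  rinc f l2 -> rinc a3 l2 -> rinc a2 l2 ->
  rinc d l3 -> rinc a3 l3 -> rinc a4 l3 ->
  rinc f l4 -> rinc a1 l4 -> rinc a4 l4 ->
  l1 <> l3 -> l1 <> l4 -> l2 <> l3 -> l2 <> l4 ->
  exists q, rinc q ldf /\ rinc q l13.
Proof.
move=> nl df a13 dd ff h1 h3 d1 a11 a21 f2 a32 a22 d3 a33 a43 f4 a14 a44 n13 n14 n23 n24.
case: ldf nl dd ff => [i|m c] nl dd ff; first exact: special_meets.
case: l13 nl h1 h3 => [i|m' c'] nl h1 h3.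
  by have [q [? ?]] := special_meets (nesym nl); exists q.
have spec q i j m0 c0 : rinc q (RO m0 c0) -> rinc q (RS i) -> rinc q (RS j) ->
    RS i = RS j by case: q => [|k y] //= _ -> ->.
case: l1 d1 a11 a21 n13 n14 => [i1|m1 c1] d1 a11 a21 n13 n14; last first.
  case: l2 f2 a32 a22 n23 n24 => [i2|m2 c2] f2 a32 a22 n23 n24; last first.
    exact: (rectangle_four a21 a22 nl df a13 d1 dd f2 ff a11 h1 a32 h3).
  case: l3 d3 a33 a43 n13 n23 => [i3|m3 c3] d3 a33 a43 n13 n23.
    by case: n23; apply: (spec a3 _ _ _ _ h3).
  case: l4 f4 a14 a44 n14 n24 => [i4|m4 c4] f4 a14 a44 n14 n24.
    by case: n24; apply: (spec f _ _ _ _ ff).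
  exact: (rectangle_four a43 a44 nl df (nesym a13) d3 dd f4 ff a33 h3 a14 h1).
case: l3 d3 a33 a43 n13 n23 => [i3|m3 c3] d3 a33 a43 n13 n23.
  by case: n13; apply: (spec d _ _ _ _ dd).
case: l4 f4 a14 a44 n14 n24 => [i4|m4 c4] f4 a14 a44 n14 n24.
  by case: n14; apply: (spec a1 _ _ _ _ h1).
exact: (rectangle_four a43 a44 nl df (nesym a13) d3 dd f4 ff a33 h3 a14 h1).
Qed.

Lemma three_indices (i : option F) :
  exists j k, [/\ i <> j, i <> k & j <> k].
Proof.
have n01 : Some (0 : F) <> Some 1 by case=> /esym/eqP; rewrite oner_eq0.
case: i => [x|]; last by exists (Some 0), (Some 1).
have [x0|x0] := eqVneq x 0; first by exists None, (Some 1); rewrite x0.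
by exists None, (Some 0); split=> // -[e]; rewrite e eqxx in x0.
Qed.

Lemma rline_two_points (l : rline) : exists q q', [/\ q <> q', rinc q l & rinc q' l].
Proof.
case: l => [i|m c]; first by exists RD, (RP i 0).
by exists (RP None m), (RP (Some 0) c); split=> //=; rewrite scale0r add0r.
Qed.

End RectangleModel.
Arguments RD {F V}.
Arguments RP {F V}.
Arguments RS {F V}.
Arguments RO {F V}.

(** * Points and lines of a matroid, and harmonic closure *)

Section MatroidLines.

Variables (E : Type) (M : matroid E).

Definition on (x : mpoint M) (l : set E) : Prop := pset x `<=` l.

Lemma cl_sub (S T : set E) : S `<=` cl M T -> cl M S `<=` cl M T.
Proof. by move=> ST; apply: subset_trans (cl_monotone ST) (@cl_idempotent _ M T). Qed.

Lemma mpoint_eq (x y : mpoint M) : pset x = pset y -> x = y.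
Proof. case: x y => [F hF] [G hG] /= FG; exact: eq_exist. Qed.

Lemma mpoint_rep (x : mpoint M) : exists u, ~ cl M set0 u /\ pset x = cl M [set u].
Proof. by case: x => F [u [nu Fu]]; exists u. Qed.

Lemma cl1_sym (u v : E) : ~ cl M set0 v -> cl M [set u] v -> cl M [set v] u.
Proof. by move=> nv uv; rewrite -[[set v]]setU0; apply: cl_exchange; rewrite ?setU0. Qed.

Lemma mpoint_neq (x y : mpoint M) u v : x <> y -> ~ cl M set0 v ->
  pset x = cl M [set u] -> pset y = cl M [set v] -> ~ cl M [set u] v.
Proof.
move=> xy nv xu yv uv; apply: xy; apply: mpoint_eq; rewrite xu yv.
apply/seteqP; split; apply: cl_sub => t -> //.
exact: cl1_sym.
Qed.

Lemma on_cl1 (x : mpoint M) u S : pset x = cl M [set u] ->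
  on x (cl M S) <-> cl M S u.
Proof.
move=> xu; rewrite /on xu; split; first by apply; apply: cl_extensive.
by move=> uS; apply: cl_sub => t ->.
Qed.

Lemma span2_cl (x y : mpoint M) u v : pset x = cl M [set u] ->
  pset y = cl M [set v] -> span2 x y = cl M [set u; v].
Proof.
move=> xu yv; rewrite /span2 xu yv; apply/seteqP; split.
  by apply: cl_sub => t []; apply: cl_monotone => s ->; [left|right].
by apply: cl_monotone => t [->|->]; [left|right]; apply: cl_extensive.
Qed.

Lemma cl2_exchange u v w : cl M [set u; v] w -> ~ cl M [set v] w ->
  cl M [set w; v] u.
Proof. exact: cl_exchange. Qed.

Lemma span2_mline (x y : mpoint M) : x <> y -> mline M (span2 x y).
Proof.
move=> xy; have [u [nu xu]] := mpoint_rep x; have [v [nv yv]] := mpoint_rep y.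
exists u, v; split=> //; last exact: span2_cl.
exact: mpoint_neq xu yv.
Qed.

Lemma on_span2l (x y : mpoint M) : on x (span2 x y).
Proof. by apply: subset_trans (@cl_extensive _ M _) => t; left. Qed.

Lemma on_span2r (x y : mpoint M) : on y (span2 x y).
Proof. by apply: subset_trans (@cl_extensive _ M _) => t; right. Qed.

(** Steinitz exchange: the elements [s], [t] spanning [l] are replaced one at a time by
    representatives [u], [v] of the two points. *)
Lemma mline_span2 (x y : mpoint M) l : x <> y -> mline M l -> on x l -> on y l ->
  l = span2 x y.
Proof.
move=> xy [s [t [ns nst lE]]].
have [u [nu xu]] := mpoint_rep x; have [v [nv yv]] := mpoint_rep y.
have nuv := mpoint_neq xy nv xu yv.
rewrite (span2_cl xu yv) lE (on_cl1 _ xu) (on_cl1 _ yv) => us vs.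
suff [hs ht] : cl M [set u; v] s /\ cl M [set u; v] t.
  by apply/seteqP; split; apply: cl_sub => w [] ->.
(* If [u] is parallel to [t], it takes the place of [t] and [v] that of [s]; otherwise [u] takes the
   place of [s], and then [v] that of [t]. *)
have [tu|ntu] := pselect (cl M [set t] u).
  have ut : cl M [set u] t := cl1_sym nu tu.
  split; last by apply: cl_monotone ut => w ->; left.
  rewrite setUC; apply: cl2_exchange => //; move: vs.
  apply: cl_sub => w [->|->]; first by apply: cl_extensive; left.
  by apply: cl_monotone ut => z ->; right.
have sut : cl M [set u; t] s by apply: cl2_exchange.
have vut : cl M [set u; t] v.
  move: vs; apply: cl_sub => w [->|->] //.
  by apply: cl_extensive; right.
have tuv : cl M [set u; v] t.
  by rewrite setUC; apply: cl2_exchange => //; rewrite setUC.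
split=> //; move: sut; apply: cl_sub => w [->|->] //.
by apply: cl_extensive; left.
Qed.

Lemma mline_uniq (x y : mpoint M) l l' : x <> y -> mline M l -> mline M l' ->
  on x l -> on y l -> on x l' -> on y l' -> l = l'.
Proof.
move=> xy ml ml' xl yl xl' yl'.
by rewrite (mline_span2 xy ml xl yl) (mline_span2 xy ml' xl' yl').
Qed.

Lemma mline_meet (x y : mpoint M) l l' : mline M l -> mline M l' -> l <> l' ->
  on x l -> on y l -> on x l' -> on y l' -> x = y.
Proof.
move=> ml ml' ll xl yl xl' yl'; apply: contrapT => xy; apply: ll.
exact: (mline_uniq xy).
Qed.

Lemma collinear3P (x y z : mpoint M) : collinear [:: x; y; z] <->
  exists l, [/\ mline M l, on x l, on y l & on z l].
Proof.
split=> [[l ml al]|[l [ml xl yl zl]]].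
  by exists l; split=> //; apply: al; rewrite /=; tauto.
by exists l => // t /= [<-|[<-|[<-|]]].
Qed.

Section HarmonicClosure.

Variable S : set (mpoint M).

Lemma iter_harmonic_step_mono k n : (k <= n)%N ->
  iter k (@harmonic_step E M) S `<=` iter n (@harmonic_step E M) S.
Proof.
elim: n => [|n IH]; first by rewrite leqn0 => /eqP ->.
by rewrite leq_eqVlt => /predU1P[->//|/IH kn] x /kn; left.
Qed.

Lemma sub_harmonic_closure : S `<=` harmonic_closure S.
Proof. by move=> x Sx; exists 0. Qed.

(** A harmonic step uses seven points at once; the iterates increase, so some iterate contains them
    all. *)
Lemma harmonic_closure_seq (s : seq (mpoint M)) :
  (forall x, List.In x s -> harmonic_closure S x) ->
  exists k, forall x, List.In x s -> iter k (@harmonic_step E M) S x.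
Proof.
elim: s => [|x s IH] hs; first by exists 0%N.
have [k hk] := IH (fun y ys => hs y (or_intror ys)).
have [n _ hn] := hs x (or_introl erefl).
exists (maxn k n) => y [<-|ys].
  by apply: iter_harmonic_step_mono hn; rewrite leq_maxr.
by apply: iter_harmonic_step_mono (hk _ ys); rewrite leq_maxl.
Qed.

Lemma harmonic_closure_step d e f a1 a2 a3 a4 h :
  (forall x, List.In x [:: d; e; f; a1; a2; a3; a4] -> harmonic_closure S x) ->
  HP d e f a1 a2 a3 a4 -> harmonic_conjugate d f e h -> harmonic_closure S h.
Proof.
move=> /harmonic_closure_seq[k hk] hp hh; exists k.+1 => //; right.
have {}hk x : List.In x [:: d; e; f; a1; a2; a3; a4] ->
  iter k (@harmonic_step E M) S x := hk x.
exists d, e, f; split; first by split; apply: hk; rewrite /=; tauto.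
split=> //; exists a1, a2, a3, a4; split=> //.
by split; apply: hk; rewrite /=; tauto.
Qed.

Lemma harmonic_closure_min (X : set (mpoint M)) :
  S `<=` X -> harmonic_step X `<=` X -> harmonic_closure S `<=` X.
Proof.
move=> SX XX x [k _]; elim: k x => [|k IH] x; first exact: SX.
case=> [/IH//|[a [b [c [[Sa Sb Sc]]]]]].
case=> [[a1 [a2 [a3 [a4 [[S1 S2 S3 S4] hp]]]]] hh].
apply: XX; right; exists a, b, c; split; first by split; apply: IH.
by split=> //; exists a1, a2, a3, a4; split=> //; split; apply: IH.
Qed.

End HarmonicClosure.

End MatroidLines.

(** * Rows of points obtained by harmonic conjugation *)

Section Coordinatization.

Variables (p : nat) (V : lmodType 'F_p) (E : Type) (M : matroid E).
Variable v0 : V.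
Hypothesis v0_neq0 : v0 <> 0.
Hypothesis hM : harmonic_matroid M.
Variable phi : Lpoint V -> E.
Hypothesis hphi : matroid_embedding (LpV V) M phi.

Lemma embedded_rank1 u : rank1_flat M (cl M [set phi u]).
Proof.
exists (phi u); split=> //; have := hphi.2 set0 u.
by rewrite image_set0 (LpV_simple V).1 => -[h _].
Qed.

Definition epoint (u : Lpoint V) : mpoint M :=
  exist (rank1_flat M) (cl M [set phi u]) (embedded_rank1 u).

Lemma epoint_inj : injective epoint.
Proof.
move=> u v /(congr1 (@pset _ _)) /= uv; have := hphi.2 [set v] u.
rewrite image_set1 (LpV_simple V).2 -uv => -[h _]; apply: h.
exact: cl_extensive.
Qed.

Lemma epoint_neq u v : u <> v -> epoint u <> epoint v.
Proof. by move=> uv /epoint_inj. Qed.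

Lemma epoint_on L u v w : Lline L -> u <> v -> L u -> L v ->
  on (epoint w) (span2 (epoint u) (epoint v)) <-> L w.
Proof.
move=> LL uv Lu Lv; rewrite (@span2_cl _ _ _ _ (phi u) (phi v)) //.
rewrite (@on_cl1 _ _ _ (phi w)) // -(LpV_cl2 uv LL Lu Lv) -hphi.2.
by rewrite image_setU !image_set1.
Qed.

Local Notation pD := (epoint LD).
Local Notation pb k := (epoint (Lb k)).
Local Notation hX := (harmonic_closure (embedded_points M phi)).

(** The line y = m x + c joins a_c = (0, c) to the point at infinity b_{-m} of slope m. Its third
    point in the embedded matroid is c_{-m-c} = (1, m + c). *)
Definition oline (m c : V) : set E := span2 (epoint (La c)) (pb (- m)).

Lemma oline_mline m c : mline M (oline m c).
Proof. exact/span2_mline/epoint_neq. Qed.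

Lemma epoint_oline u m c : on (epoint u) (oline m c) <->
  [set La c; Lb (- m); Lc (- m - c)] u.
Proof.
apply: epoint_on => //; last by left; right.
- by apply: Or44; exists c, (- m - c); rewrite [c + _]addrC subrK.
- by left; left.
Qed.

Lemma oline_a g m c : on (epoint (La g)) (oline m c) <-> g = c.
Proof. by rewrite epoint_oline; split=> [[[[]|]|]//|->]; left; left. Qed.

Lemma oline_b k m c : on (pb k) (oline m c) <-> k = - m.
Proof. by rewrite epoint_oline; split=> [[[|[]]|]//|->]; left; right. Qed.

Lemma oline_c m c : on (epoint (Lc (- m - c))) (oline m c).
Proof. by rewrite epoint_oline; right. Qed.

Lemma oline_D m c : ~ on pD (oline m c).
Proof. by rewrite epoint_oline => -[[]|]. Qed.

Lemma oline_span2 z m c : on z (oline m c) -> z <> pb (- m) ->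
  span2 z (pb (- m)) = oline m c.
Proof.
move=> zl zb; rewrite (mline_span2 zb (oline_mline m c) zl) //.
exact/oline_b.
Qed.

Lemma epoint_special (L : set (Lpoint V)) u v : Lline L -> L LD -> L u -> L v ->
  u <> LD -> collinear [:: pD; epoint u; epoint v].
Proof.
move=> LL LD' Lu Lv uD; apply/collinear3P; exists (span2 pD (epoint u)).
have ok w : L w -> on (epoint w) (span2 pD (epoint u)).
  by move=> Lw; apply/(epoint_on w LL) => // /esym.
by split; [exact/span2_mline/epoint_neq/nesym| | |]; apply: ok.
Qed.

(** The point (x, y) is described only by the ordinary lines through it: the one of slope [m] has
    intercept y - x m. This applies equally to embedded points and to points constructed in [M]. *)
Definition pencil (x : 'F_p) (P : V -> mpoint M) : Prop :=
  forall y m, on (P y) (oline m (y - x *: m)).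

Lemma pencil_neqD x P y : pencil x P -> P y <> pD.
Proof. by move=> hP yD; apply: (@oline_D 0 (y - x *: 0)); rewrite -yD. Qed.

Lemma pencil_neqb x P y k : pencil x P -> P y <> pb k.
Proof.
(* The slope [v0 - k] differs from the slope [- k] of the ordinary lines through [pb k]. *)
move=> /(_ y (v0 - k)) + yb; rewrite yb oline_b opprB => /eqP.
by rewrite -subr_eq0 opprB addrCA subrr addr0 => /eqP.
Qed.

(** Two different lines of slope [m] meet only in [pb (- m)], which is no point of a pencil. *)
Lemma pencil_on x P y m c : pencil x P -> on (P y) (oline m c) -> y = x *: m + c.
Proof.
move=> hP yl; suff -> : c = y - x *: m by rewrite addrC subrK.
apply: contrapT => cy; apply: (pencil_neqb (y := y) (k := - m) hP).
apply: (mline_meet (oline_mline m c) (oline_mline m (y - x *: m))) => //.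
- move=> ll; apply: cy; apply/(oline_a _ m); rewrite -ll.
  exact/oline_a.
- exact/oline_b.
- exact/oline_b.
Qed.

Lemma pencil_inj x P x' P' y y' : pencil x P -> pencil x' P' -> P y = P' y' ->
  y = y'.
Proof.
move=> hP hP' e; have := hP y 0; rewrite e => /(pencil_on hP').
by rewrite !scaler0 subr0 add0r.
Qed.

(** A common point would have the same ordinate in both pencils, and the line of slope [v0] through
    it would give x v0 = x' v0. *)
Lemma pencil_neq x P x' P' y y' : pencil x P -> pencil x' P' -> x <> x' ->
  P y <> P' y'.
Proof.
move=> hP hP' xx e; have yy := pencil_inj hP hP' e.
have := hP y v0; rewrite e yy => /(pencil_on hP')/eqP.
rewrite addrCA -[X in X == _]addr0 (inj_eq (addrI _)) eq_sym -scalerBl.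
rewrite scaler_eq0 subr_eq0 => /orP[/eqP e'|/eqP//].
by apply: xx.
Qed.

Lemma pencil_shift x P y m : pencil x P -> on (P y) (oline m (y + m - (x + 1) *: m)).
Proof.
by move=> /(_ y m); rewrite scalerDl scale1r opprD addrACA subrr addr0.
Qed.

Lemma pencil0 x P y : pencil x P -> on (P y) (oline 0 y).
Proof. by move=> /(_ y 0); rewrite scaler0 subr0. Qed.

(** The invariant of the recursion on the abscissa: collinearity with D serves to build the next
    configurations, and membership in the closure to stay inside it. *)
Definition special_row (x : 'F_p) (P : V -> mpoint M) : Prop :=
  [/\ pencil x P, forall y y', collinear [:: pD; P y; P y'] & forall y, hX (P y)].

Lemma epoint_closure u : hX (epoint u).
Proof. by apply: sub_harmonic_closure; exists u. Qed.

Section Step.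

Variables (x : 'F_p) (P Q : V -> mpoint M).
Hypotheses (rP : special_row x P) (rQ : special_row (x + 1) Q).

Let hP : pencil x P. Proof. by case: rP. Qed.
Let hQ : pencil (x + 1) Q. Proof. by case: rQ. Qed.
Let x1 : x <> x + 1.
Proof. by move/eqP; rewrite -[X in X == _]addr0 (inj_eq (addrI _)) eq_sym oner_eq0. Qed.

Let B_collinear k k' : collinear [:: pb k; pb k'; pD].
Proof.
have /collinear3P[l [ml ? ? ?]] : collinear [:: pD; pb k; pb k'].
  apply: (@epoint_special (range (@Lb V) `|` [set LD])) => //.
  - exact: Or42.
  - by right.
  - by left; exists k.
  - by left; exists k'.
by apply/collinear3P; exists l.
Qed.

Let shift_neq (y s : V) : s <> 0 -> y <> y + s.
Proof. by move=> s0 /eqP; rewrite -subr_eq0 opprD addNKr oppr_eq0 => /eqP. Qed.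

(** The line joining [Q y] to [pb 0] is horizontal, and D lies on no ordinary line. *)
Let base_not_collinear y s : List.In (Q y) s -> List.In (pb 0) s ->
  List.In pD s -> ~ collinear s.
Proof.
move=> Qs bs Ds [l ml al].
suff ll : l = oline 0 y by apply: (@oline_D 0 y); rewrite -ll; apply: al.
apply: (mline_uniq (pencil_neqb (k := 0) hQ) ml (oline_mline _ _)) (al _ Qs) (al _ bs) _ _.
  exact: pencil0 hQ.
by apply/oline_b; rewrite oppr0.
Qed.

Let base_collinear y : collinear [:: Q y; P y; pb 0].
Proof.
apply/collinear3P; exists (oline 0 y); split; first exact: oline_mline.
- exact: pencil0 hQ.
- exact: pencil0 hP.
- by apply/oline_b; rewrite oppr0.
Qed.

Ltac nodup7 :=
  rewrite !List.NoDup_cons_iff /=;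
  repeat match goal with |- _ /\ _ => split end;
  try exact: List.NoDup_nil;
  let H := fresh in intros H; repeat destruct H as [H|H]; try exact H;
  move: H.

(** In coordinates d = (x+1, y), e = (x, y), a1 = (x+1, y+s), a4 = (x, y+s), and a3 is the point at
    infinity of slope -s. The line a1 a3 is the line of slope -s through (x+2, y); it takes every
    nonzero slope as [s] varies. *)
Lemma harmonic_conf1 y s : s <> 0 ->
  HP (Q y) (P y) (pb 0) (Q (y + s)) pD (pb s) (P (y + s)).
Proof.
move=> s0; have ys := shift_neq (y := y) s0.
have [_ cP _] := rP; have [_ cQ _] := rQ.
split; [|split; [|split; [|split| |split]]].
- nodup7; try (move/esym; exact: pencil_neq x1); try exact: pencil_neq x1;
    try exact: pencil_neqD; try exact: pencil_neqb; try exact: epoint_neq;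
    try (move/esym; exact: pencil_neqD); try (move/esym; exact: pencil_neqb).
  + by move/(pencil_inj hQ hQ)/esym.
  + by move/(pencil_inj hP hP)/esym.
  + by move/epoint_inj => -[].
- by apply: (@base_not_collinear y) => /=; tauto.
- exact: base_collinear.
- by have /collinear3P[l [ml ? ? ?]] := cQ y (y + s); apply/collinear3P; exists l.
- apply/collinear3P; exists (oline (- s) (y - (x + 1) *: - s)).
  split; first exact: oline_mline.
  + exact: hQ.
  + by have := @pencil_shift x P (y + s) (- s) hP; rewrite addrK.
  + by apply/oline_b; rewrite opprK.
- by have /collinear3P[l [ml ? ? ?]] := cP y (y + s); apply/collinear3P; exists l.
- apply/collinear3P; exists (oline 0 (y + s)); split; first exact: oline_mline.
  + by apply/oline_b; rewrite oppr0.
  + exact: pencil0 hP.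
  + exact: pencil0 hQ.
- by have /collinear3P[l [ml ? ? ?]] := B_collinear 0 s; apply/collinear3P; exists l.
Qed.

(** Here a1 = D, a2 = (x+1, y+s), a3 = (x+2, y+s), and a4 is the point at infinity of slope s. The
    conjugate is thereby forced onto the line joining D to (x+2, y+s). *)
Lemma harmonic_conf2 H y s : pencil (x + 1 + 1) H -> s <> 0 ->
  HP (Q y) (P y) (pb 0) pD (Q (y + s)) (H (y + s)) (pb (- s)).
Proof.
move=> hH s0; have ys := shift_neq (y := y) s0.
have x2 : x + 1 <> x + 1 + 1 by move/addIr.
have [_ cP _] := rP; have [_ cQ _] := rQ.
split; [|split; [|split; [|split| |split]]].
- nodup7; try (move/esym; exact: pencil_neq x1); try exact: pencil_neq x1;
    try exact: pencil_neq x2; try (move/esym; exact: pencil_neq x2);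
    try exact: pencil_neqD; try exact: pencil_neqb; try exact: epoint_neq;
    try (move/esym; exact: pencil_neqD); try (move/esym; exact: pencil_neqb).
  + by move/(pencil_inj hQ hQ)/esym.
  (* For p = 2 the abscissas x + 2 and x agree; the ordinates still separate the two points. *)
  + by move/(pencil_inj hH hP)/esym.
  + by move/epoint_inj => -[] /eqP; rewrite oppr_eq0 => /eqP.
- by apply: (@base_not_collinear y) => /=; tauto.
- exact: base_collinear.
- by have /collinear3P[l [ml ? ? ?]] := cQ y (y + s); apply/collinear3P; exists l.
- apply/collinear3P; exists (oline s (y - (x + 1) *: s)).
  split; first exact: oline_mline.
  + exact: hQ.
  + exact/oline_b.
  + by have := hH (y + s) s; rewrite [(x + 1 + 1) *: s]scalerDl scale1r opprD addrACA subrr addr0.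
- apply/collinear3P; exists (oline s (y - x *: s)).
  split; first exact: oline_mline.
  + exact: hP.
  + exact/oline_b.
  + by have := @hQ (y + s) s; rewrite scalerDl scale1r opprD addrACA subrr addr0.
- by have /collinear3P[l [ml ? ? ?]] := B_collinear 0 (- s); apply/collinear3P; exists l.
- apply/collinear3P; exists (oline 0 (y + s)); split; first exact: oline_mline.
  + by apply/oline_b; rewrite oppr0.
  + exact: pencil0 hH.
  + exact: pencil0 hQ.
Qed.

Lemma special_row_step : exists H, special_row (x + 1 + 1) H.
Proof.
(* The conjugate depends on the base triple only, so one point serves all [s]. *)
have /choice[H cH] y : exists h, harmonic_conjugate (Q y) (pb 0) (P y) h.
  exact: hM (harmonic_conf1 y v0_neq0).
have hH : pencil (x + 1 + 1) H.
  move=> y m; have [->|/eqP m0] := eqVneq m 0.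
    (* The horizontal line is not obtained as a line a1 a3; it is the line d f. *)
    have [_] := cH y _ _ _ _ (harmonic_conf1 y v0_neq0).
    rewrite scaler0 subr0 -(@oline_span2 (Q y)) ?oppr0 //; first exact: pencil0 hQ.
    exact: pencil_neqb hQ.
  have m0' : - m <> 0 by move/eqP; rewrite oppr_eq0 => /eqP.
  (* For s = - m the line a1 a3 has slope [m] and passes through (x+1, y-m). *)
  have [+ _] := cH y _ _ _ _ (harmonic_conf1 y m0').
  rewrite (@oline_span2 _ m (y - (x + 1 + 1) *: m)) //.
    by have := @pencil_shift (x + 1) Q (y - m) m hQ; rewrite subrK.
  exact: pencil_neqb hQ.
exists H; split=> // [y y'|y].
  have [-> |/eqP yy] := eqVneq y' y.
    apply/collinear3P; exists (span2 pD (H y)).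
    split; [|exact: on_span2l|exact: on_span2r|exact: on_span2r].
    by apply: span2_mline => /esym; apply: pencil_neqD hH.
  have s0 : y' - y <> 0 by move/subr0_eq.
  (* For s = y' - y the points a1 and a3 are D and [H y']. *)
  have [+ _] := cH y _ _ _ _ (harmonic_conf2 y hH s0).
  rewrite addrC subrK => Hy; apply/collinear3P; exists (span2 pD (H y')).
  split; [|exact: on_span2l|exact: Hy|exact: on_span2r].
  by apply: span2_mline => /esym; apply: pencil_neqD hH.
have [_ _ XP] := rP; have [_ _ XQ] := rQ.
apply: harmonic_closure_step (harmonic_conf1 y v0_neq0) (cH y) => z /=.
move=> [<-|[<-|[<-|[<-|[<-|[<-|[<-|//]]]]]]]; [exact: XQ|exact: XP| |exact: XQ| | |exact: XP];
  exact: epoint_closure.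
Qed.

End Step.

Lemma special_row0 : special_row 0 (fun y => epoint (La y)).
Proof.
split=> [y m|y y'|y]; last exact: epoint_closure.
  by rewrite scale0r subr0; apply/oline_a.
apply: (@epoint_special (range (@La V) `|` [set LD])) => //.
- exact: Or41.
- by right.
- by left; exists y.
- by left; exists y'.
Qed.

Lemma special_row1 : special_row 1 (fun y => epoint (Lc (- y))).
Proof.
split=> [y m|y y'|y]; last exact: epoint_closure.
  by have := @oline_c m (y - 1 *: m); rewrite scale1r opprB addrA addNr add0r.
apply: (@epoint_special (range (@Lc V) `|` [set LD])) => //.
- exact: Or43.
- by right.
- by left; exists (- y).
- by left; exists (- y').
Qed.

(** Each step needs two consecutive rows, so two are carried along the natural numbers, which
    represent all elements of ['F_p]. *)
Lemma special_row_ex x : exists P, special_row x P.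
Proof.
suff /(_ x)[] : forall n : nat, (exists P, special_row n%:R P) /\
    (exists P, special_row (n%:R + 1) P) by rewrite natr_Zp.
elim=> [|n [[P hP] [Q hQ]]].
  split; first by exists (fun y => epoint (La y)); apply: special_row0.
  by exists (fun y => epoint (Lc (- y))); rewrite add0r; apply: special_row1.
by rewrite -natr1; split; [exists Q|apply: special_row_step hP hQ].
Qed.

Lemma pencil_rows : exists J : option 'F_p -> V -> mpoint M,
  [/\ forall i y m c, on (J i y) (oline m c) <-> y = ev i m c,
      forall i y y', collinear [:: pD; J i y; J i y'],
      forall i y, hX (J i y)
    & forall u, u <> LD -> exists i y, epoint u = J i y].
Proof.
have [R hR] := choice special_row_ex.
(* The sign makes [y] the slope of the ordinary lines through the point at infinity. *)
exists (fun i => if i is Some x then R x else fun y => pb (- y)).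
have [pR cR XR] : [/\ forall x, pencil x (R x),
    forall x y y', collinear [:: pD; R x y; R x y'] & forall x y, hX (R x y)].
  by split=> x; case: (hR x).
(* A point of a pencil is the intersection of a horizontal line with one of slope [v0]; hence the
   chosen rows 0 and 1 are the embedded rows A and C. *)
have uniq x P : pencil x P -> forall y, P y = R x y.
  move=> hP y; apply: (mline_meet (oline_mline 0 y) (oline_mline v0 (y - x *: v0))).
  - move=> ll; apply: v0_neq0; apply: oppr_inj; rewrite oppr0.
    by apply/esym/(oline_b 0 v0 (y - x *: v0)); rewrite -ll; apply/oline_b; rewrite oppr0.
  - exact: pencil0 hP.
  - exact: pencil0 (pR x).
  - exact: hP.
  - exact: pR.
split=> [[x|] y m c|[x|] y y'|[x|] y|u uD] //=.
- split; first exact: pencil_on.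
  by move=> ->; have := pR x (x *: m + c) m; rewrite addrAC subrr add0r.
- by rewrite oline_b; split=> [/oppr_inj|->].
- apply: (@epoint_special (range (@Lb V) `|` [set LD])) => //.
  + exact: Or42.
  + by right.
  + by left; exists (- y).
  + by left; exists (- y').
- exact: epoint_closure.
- case: u uD => [g|k|h|] // _.
  + by exists (Some 0), g; apply: (uniq 0 (fun y => epoint (La y))); case: special_row0.
  + by exists None, (- k); rewrite opprK.
  + exists (Some 1), (- h); rewrite -(uniq 1 (fun y => epoint (Lc (- y)))) ?opprK //.
    by case: special_row1.
Qed.

End Coordinatization.

(** * The explicit rectangle inside a matroid *)

Section RectangleInMatroid.

Variables (F : fieldType) (V : lmodType F) (E : Type) (M : matroid E).
Variable v0 : V.
Hypothesis v0_neq0 : v0 <> 0.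
Variables (D : mpoint M) (J : option F -> V -> mpoint M) (ol : V -> V -> set E).
Hypothesis ol_mline : forall m c, mline M (ol m c).
Hypothesis on_ol : forall i y m c, on (J i y) (ol m c) <-> y = ev i m c.
Hypothesis D_ol : forall m c, ~ on D (ol m c).
Hypothesis D_collinear : forall i y y', collinear [:: D; J i y; J i y'].

Definition rpt (q : rpoint V) : mpoint M := if q is RP i y then J i y else D.

Definition rln (l : rline V) : set E :=
  match l with RS i => span2 D (J i 0) | RO m c => ol m c end.

Lemma J_neqD i y : J i y <> D.
Proof.
have [j [_ [ij _ _]]] := three_indices i.
have [m [c [<- _]]] := ev_interp y 0 ij.
by move=> e; apply: (@D_ol m c); rewrite -e; apply/on_ol.
Qed.

(** For different indices some line takes the value [y] at [i] and [z + v0] at [j]; it contains the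
    first point but not the second. *)
Lemma J_index i y j z : J i y = J j z -> i = j.
Proof.
move=> e; apply: contrapT => ij.
have [m [c [ei ej]]] := ev_interp y (z + v0) ij.
have : on (J i y) (ol m c) by apply/on_ol.
rewrite e on_ol ej => /eqP.
by rewrite -subr_eq0 opprD addNKr oppr_eq0 => /eqP.
Qed.

Lemma rpt_inj : injective rpt.
Proof.
move=> [|i y] [|j z] //=; first by move=> /esym /J_neqD.
  by move=> /J_neqD.
move=> e; have ij := J_index e; move: e; rewrite {}ij => e; congr RP.
have [k [_ [ik _ _]]] := three_indices j.
have [m [c [ei _]]] := ev_interp y 0 ik.
have : on (J j y) (ol m c) by apply/on_ol.
by rewrite e on_ol ei => ->.
Qed.

Lemma rpt_neq q q' : q <> q' -> rpt q <> rpt q'.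
Proof. by move=> qq /rpt_inj. Qed.

Lemma rln_mline l : mline M (rln l).
Proof. by case: l => [i|m c] //=; apply: span2_mline => /esym; apply: J_neqD. Qed.

Lemma rpt_on q l : on (rpt q) (rln l) <-> rinc q l.
Proof.
case: q l => [|i y] [j|m c] /=.
- by split=> // _; apply: on_span2l.
- by split=> // /D_ol.
- have sp k z : on (J k z) (span2 D (J k 0)).
    have /collinear3P[l [ml lD l0 lz]] := D_collinear k 0 z.
    by rewrite -(mline_span2 (nesym (@J_neqD k 0)) ml lD l0).
  split=> [h|->]; last exact: sp.
  (* Otherwise the ordinary line through [J i y] and [J j 0] would be this special line and contain
     D. *)
  apply: contrapT => ij; have [m [c [ei ej]]] := ev_interp y 0 ij.
  apply: (@D_ol m c); suff -> : ol m c = span2 D (J j 0) by apply: on_span2l.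
  apply: (@mline_uniq _ _ (J i y) (J j 0)) => //.
  + by move=> /J_index.
  + by apply: span2_mline => /esym; apply: J_neqD.
  + exact/on_ol.
  + exact/on_ol.
- exact: on_ol.
Qed.

Lemma rln_span2 q q' l : q <> q' -> rinc q l -> rinc q' l ->
  span2 (rpt q) (rpt q') = rln l.
Proof.
move=> qq ql ql'; apply/esym/mline_span2; first exact: rpt_neq.
- exact: rln_mline.
- exact/rpt_on.
- exact/rpt_on.
Qed.

Lemma rpt_collinear q q' q'' : q <> q' ->
  collinear [:: rpt q; rpt q'; rpt q''] ->
  exists l, [/\ rinc q l, rinc q' l & rinc q'' l].
Proof.
move=> qq /collinear3P[l [ml ql ql' ql'']].
have [k [qk qk']] := rline_through qq.
exists k; split=> //; apply/rpt_on.
by rewrite -(rln_span2 qq qk qk') -(mline_span2 (rpt_neq qq) ml).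
Qed.

Lemma rln_eq l l' : rln l = rln l' -> l = l'.
Proof.
move=> ll; have [q [q' [qq ql ql']]] := rline_two_points l.
by apply: (rinc_same qq) => //; apply/rpt_on; rewrite -ll; apply/rpt_on.
Qed.

(** By [rectangle_harmonic] the lines d f and a1 a3 meet in a point of the rectangle. This point is
    [h], since two different matroid lines share at most one point. *)
Lemma rpt_harmonic d e f a1 a2 a3 a4 h :
  HP (rpt d) (rpt e) (rpt f) (rpt a1) (rpt a2) (rpt a3) (rpt a4) ->
  harmonic_conjugate (rpt d) (rpt f) (rpt e) h -> exists q, h = rpt q.
Proof.
move=> hp hh; have [h13 hdf] := hh _ _ _ _ hp.
case: hp => nd [nc [cdef [c1 c3] c5 [c4 c2]]].
have neq q q' : rpt q <> rpt q' -> q <> q' by move=> + qq; rewrite qq.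
move: nd; rewrite !List.NoDup_cons_iff /=.
move=> [nd [ne [nf [n1 [n2 _]]]]].
have de : d <> e by apply: neq => /esym ?; apply: nd; tauto.
have df : d <> f by apply: neq => /esym ?; apply: nd; tauto.
have da1 : d <> a1 by apply: neq => /esym ?; apply: nd; tauto.
have da4 : d <> a4 by apply: neq => /esym ?; apply: nd; tauto.
have ea4 : e <> a4 by apply: neq => /esym ?; apply: ne; tauto.
have fa4 : f <> a4 by apply: neq => /esym ?; apply: nf; tauto.
have fa3 : f <> a3 by apply: neq => /esym ?; apply: nf; tauto.
have a13 : a1 <> a3 by apply: neq => /esym ?; apply: n1; tauto.
have a24 : a2 <> a4 by apply: neq => /esym ?; apply: n2; tauto.
have fa1 : f <> a1 by apply: neq => /esym ?; apply: nf; tauto.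
have ef : e <> f by apply: neq => /esym ?; apply: ne; tauto.
have da2 : d <> a2 by apply: neq => /esym ?; apply: nd; tauto.
have [l0 [d0 e0 f0]] := rpt_collinear de cdef.
have [l1 [d1 a11 a21]] := rpt_collinear da1 c1.
have [l3 [d3 a43 a33]] := rpt_collinear da4 c3.
have [l5 [e5 a45 a25]] := rpt_collinear ea4 c5.
have [l4 [f4 a44 a14']] := rpt_collinear fa4 c4.
have [l2 [f2 a32 a22]] := rpt_collinear fa3 c2.
have [l6 [a16 a36]] := rline_through a13.
(* Each coincidence of lines excluded below would spread to one line through all seven points. *)
have all_on l : rinc d l -> rinc e l -> rinc f l -> rinc a1 l -> rinc a2 l ->
    rinc a3 l -> rinc a4 l -> False.
  move=> *; apply: nc; exists (rln l); first exact: rln_mline.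
  by move=> t /= [<-|[<-|[<-|[<-|[<-|[<-|[<-|//]]]]]]]; apply/rpt_on.
have l06 : l0 <> l6.
  move=> e06; rewrite -{}e06 in a16 a36 *.
  have e1 := rinc_same da1 d0 a16 d1 a11.
  have e4 := rinc_same fa1 f0 a16 f4 a14'.
  by rewrite -e1 -e4 in a21 a44; apply: (all_on l0).
have l13 : l1 <> l3.
  move=> e13; rewrite -{}e13 in d3 a43 a33.
  have e5' := rinc_same a24 a21 a43 a25 a45; rewrite -e5' in e5.
  have e0' := rinc_same de d1 e5 d0 e0; rewrite -e0' in f0.
  exact: (all_on l1).
have l14 : l1 <> l4.
  move=> e14; rewrite -{}e14 in f4 a44 a14'.
  have e5' := rinc_same a24 a21 a44 a25 a45; rewrite -e5' in e5.
  have e3' := rinc_same da4 d1 a44 d3 a43; rewrite -e3' in a33.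
  exact: (all_on l1).
have l23 : l2 <> l3.
  move=> e23; rewrite -{}e23 in d3 a43 a33.
  have e5' := rinc_same a24 a22 a43 a25 a45; rewrite -e5' in e5.
  have e1' := rinc_same da2 d3 a22 d1 a21; rewrite -e1' in a11.
  exact: (all_on l2).
have l24 : l2 <> l4.
  move=> e24; rewrite -{}e24 in f4 a44 a14'.
  have e5' := rinc_same a24 a22 a44 a25 a45; rewrite -e5' in e5.
  have e0' := rinc_same ef e5 f4 e0 f0; rewrite -e0' in d0.
  exact: (all_on l2).
have [q [q0 q6]] := rectangle_harmonic l06 df a13 d0 f0 a16 a36 d1 a11 a21
  f2 a32 a22 d3 a33 a43 f4 a14' a44 l13 l14 l23 l24.
exists q; apply: (mline_meet (rln_mline l0) (rln_mline l6)).
- by move=> /rln_eq.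
- by rewrite -(rln_span2 df d0 f0).
- exact/rpt_on.
- by rewrite -(rln_span2 a13 a16 a36).
- exact/rpt_on.
Qed.

Lemma harmonic_closure_rpt (S : set (mpoint M)) :
  (forall x, S x -> exists q, x = rpt q) -> (forall q, harmonic_closure S (rpt q)) ->
  harmonic_closure S = range rpt.
Proof.
move=> hS hq; apply/seteqP; split; last by move=> _ [q _ <-].
apply: harmonic_closure_min; first by move=> x /hS[q ->]; exists q.
move=> x [//|[a [b [c [[[d _ <-] [e _ <-] [f _ <-]]]]]]].
move=> [[_ [_ [_ [_ [[[a1 _ <-] [a2 _ <-] [a3 _ <-] [a4 _ <-]] hp]]]]] hh].
by have [q ->] := rpt_harmonic hp hh; exists q.
Qed.

End RectangleInMatroid.

Lemma card_finType (T : finType) : [set: T] #= `I_(#|T|).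
Proof.
rewrite (card_eqr card_II) card_eq_sym.
have -> : [set: 'I_#|T|] = @enum_rank T @` [set: T].
  by apply/seteqP; split=> // i _; exists (enum_val i) => //; apply: enum_valK.
by apply: inj_card_eq; apply: in2W; apply: enum_rank_inj.
Qed.

Lemma NoDup3 (T : Type) (x y z : T) :
  List.NoDup [:: x; y; z] <-> [/\ x <> y, x <> z & y <> z].
Proof.
rewrite !List.NoDup_cons_iff /=; split.
  by move=> [nx [ny _]]; split=> e; [apply: nx|apply: nx|apply: ny]; rewrite e; tauto.
move=> [xy xz yz]; split; first by case=> [/esym|[/esym|]].
split; first by case=> [/esym|].
by split=> //; apply: List.NoDup_nil.
Qed.

(** * Incidence structures isomorphic to the explicit rectangle *)

Section Transfer.

Variables (F : fieldType) (V : lmodType F) (v0 : V).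
Hypothesis v0_neq0 : v0 <> 0.
Variable I : incidence.
Variables (pt : rpoint V -> ipoint I) (ln : rline V -> iline I).
Hypothesis pt_inj : injective pt.
Hypothesis pt_surj : forall x, exists q, x = pt q.
Hypothesis ln_surj : forall l, exists k, l = ln k.
Hypothesis inc_pt : forall q l, inc (pt q) (ln l) <-> rinc q l.

Let inc_ptE q l : inc (pt q) (ln l) = rinc q l.
Proof. exact/propext/inc_pt. Qed.

Lemma ln_inj : injective ln.
Proof.
move=> l l' ll; have [q [q' [qq ql ql']]] := rline_two_points l.
by apply: (rinc_same qq) => //; apply/inc_pt; rewrite -ll; apply/inc_pt.
Qed.

Lemma inc_same (x y : ipoint I) (l l' : iline I) : x <> y ->
  inc x l -> inc y l -> inc x l' -> inc y l' -> l = l'.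
Proof.
have [[q ->] [q' ->]] := (pt_surj x, pt_surj y).
have [[k ->] [k' ->]] := (ln_surj l, ln_surj l').
rewrite !inc_ptE => qq ql ql' qk qk'; congr ln.
by apply: (rinc_same _ ql ql') => // e; apply: qq; rewrite e.
Qed.

Lemma transfer_unique_line : unique_line I.
Proof.
move=> x y xy; have [[q xq] [q' yq]] := (pt_surj x, pt_surj y).
have qq : q <> q' by move=> qq; apply: xy; rewrite xq yq qq.
have [l [ql ql']] := rline_through qq; exists (ln l).
split; first by rewrite xq yq !inc_ptE.
by move=> l' [xl yl]; apply: (inc_same xy) => //; rewrite ?xq ?yq inc_pt.
Qed.

Lemma transfer_meet (x y : ipoint I) (l l' : iline I) : l <> l' ->
  inc x l -> inc y l -> inc x l' -> inc y l' -> x = y.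
Proof.
by move=> ll xl yl xl' yl'; apply: contrapT => xy; apply: ll; apply: (inc_same xy).
Qed.

Lemma transfer_special_meets : special_meets_all (pt RD).
Proof.
move=> l l'; have [[k ->] [k' ->]] := (ln_surj l, ln_surj l').
rewrite inc_pt; case: k => [i|//] _ kk.
have [|q [qi qk]] := @special_meets _ _ i k'; first by move=> e; apply: kk; rewrite e.
exists (pt q); split; first by split; apply/inc_pt.
by move=> x [xl xl']; apply: (transfer_meet kk) => //; apply/inc_pt.
Qed.

Lemma transfer_four_point : four_point_axiom (pt RD).
Proof.
move=> l1 l2 + + _ [x].
have [[q ->] [k1 ->] [k2 ->]] := And3 (pt_surj x) (ln_surj l1) (ln_surj l2).
case: k1 => [i|m1 c1]; first by rewrite inc_pt => -[].
case: k2 => [i|m2 c2]; first by rewrite !inc_ptE => _ [].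
move=> _ _ [q1 q2] l3 l4 l34 [x13 [x23 [x14 [x24 [nd]]]]].
move: nd l34 q1 q2; have [[k3 ->] [k4 ->]] := (ln_surj l3, ln_surj l4).
have [[q13 ->] [q23 ->]] := (pt_surj x13, pt_surj x23).
have [[q14 ->] [q24 ->]] := (pt_surj x14, pt_surj x24).
rewrite !inc_ptE => nd l34 q1 q2 [a1 a2] [a3 a4] [a5 a6] [a7 a8].
have [q0 [q3 q4]] : exists q0, rinc q0 k3 /\ rinc q0 k4.
  apply: (rectangle_four q1 q2 _ _ _ a1 a2 a3 a4 a5 a6 a7 a8).
  - by move=> e; apply: l34; rewrite e.
  - by move=> e; move: nd; rewrite List.NoDup_cons_iff e /=; tauto.
  - move=> e; move: nd; rewrite !List.NoDup_cons_iff e /=; tauto.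
by exists (pt q0); rewrite !inc_ptE.
Qed.

Lemma transfer_three_points : lines_have_3_points I.
Proof.
move=> l; have [k ->] := ln_surj l.
have neq q q' : q <> q' -> pt q <> pt q' by move=> qq /pt_inj.
case: k => [i|m c].
  exists (pt RD), (pt (RP i 0)), (pt (RP i v0)); rewrite NoDup3 !inc_ptE.
  by split=> //; split; apply: neq => // -[] /esym.
exists (pt (RP None m)), (pt (RP (Some 0) c)), (pt (RP (Some 1) (m + c))).
rewrite NoDup3 !inc_ptE /= scale0r scale1r add0r.
split=> //; split; apply: neq => // -[] /esym/eqP.
by rewrite oner_eq0.
Qed.

Lemma transfer_quadrangle : has_quadrangle I.
Proof.
have n01 : (0 : F) <> 1 by move=> /esym/eqP; rewrite oner_eq0.
pose o i y : rpoint V := RP (Some i) y.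
(* A line with two points of one row is special and misses the other rows. *)
have key i j y z z' : i <> j -> z <> z' -> forall k,
    [/\ rinc (o i z) k, rinc (o i z') k & rinc (o j y) k] -> False.
  move=> ij zz [k|m c] [/= e1 e2 e3]; first by apply: ij; move: e3; rewrite -e1 => -[].
  by apply: zz; rewrite e1 e2.
have oneq i j y z : i <> j \/ y <> z -> o i y <> o j z by move=> h [??]; case: h.
have v0' : (0 : V) <> v0 by move/esym.
have icol x y z : icollinear (pt x) (pt y) (pt z) -> exists k,
    [/\ rinc x k, rinc y k & rinc z k].
  by move=> [l]; have [k ->] := ln_surj l; rewrite !inc_ptE; exists k.
exists (pt (o 0 0)), (pt (o 0 v0)), (pt (o 1 0)), (pt (o 1 v0)); split.
- rewrite !List.NoDup_cons_iff /=.
  have n10 := nesym n01.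
  split; first by move=> [|[|[|//]]] /pt_inj; apply: oneq; tauto.
  split; first by move=> [|[|//]] /pt_inj; apply: oneq; tauto.
  split; first by move=> [|//] /pt_inj; apply: oneq; tauto.
  by split=> //; apply: List.NoDup_nil.
- by move=> /icol[k h]; apply: (key 0 1 _ _ _ n01 v0' k h).
- by move=> /icol[k h]; apply: (key 0 1 _ _ _ n01 v0' k h).
- move=> /icol[k [h1 h2 h3]]; apply: (key 1 0 0 0 v0 (nesym n01) v0' k); split=> //.
- move=> /icol[k [h1 h2 h3]]; apply: (key 1 0 v0 0 v0 (nesym n01) v0' k); split=> //.
Qed.

Lemma transfer_rectangle : projective_rectangle (pt RD).
Proof.
split; first exact: transfer_unique_line.
split; [exact: transfer_quadrangle|exact: transfer_three_points| |].
  exact: transfer_special_meets.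
exact: transfer_four_point.
Qed.

(** Special lines correspond to indices, and the points other than D of the special line at infinity
    to slopes. *)
Lemma transfer_order (m : Type) : [set: option F] #= [set: option m] ->
  rectangle_order (pt RD) m V.
Proof.
move=> Fm; split.
  rewrite -(card_eqr Fm).
  have -> : [set l | inc (pt RD) l] = (fun i => ln (RS i)) @` [set: option F].
    apply/seteqP; split=> [l /=|_ [i _ <-] /=]; last exact/inc_pt.
    have [k ->] := ln_surj l; rewrite inc_pt; case: k => [i|//] _.
    by exists i.
  by apply: inj_card_eq; apply: in2W => i j /ln_inj[].
exists (ln (RS None)); split; first exact/inc_pt.
pose h (o : option V) := pt (if o is Some y then RP None y else RD).
have -> : [set x | inc x (ln (RS None))] = h @` [set: option V].
  apply/seteqP; split=> [x /=|_ [i _ <-] /=]; last first.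
    by rewrite /h; case: i => [y|]; apply/inc_pt.
  have [[|i y] ->] := pt_surj x; first by exists None.
  by rewrite inc_pt => /= ->; exists (Some y).
by apply: inj_card_eq; apply: in2W => -[y|] [z|] // /pt_inj // [->].
Qed.

End Transfer.

(** * Perspectivities in projective planes *)

Lemma unique_line_same (I : incidence) (x y : ipoint I) (l l' : iline I) :
  unique_line I -> x <> y -> inc x l -> inc y l -> inc x l' -> inc y l' -> l = l'.
Proof.
move=> ul xy xl yl xl' yl'; have [k [_ ku]] := ul x y xy.
by rewrite -(ku l) ?(ku l').
Qed.

(** Projection from [q] is a bijection between the points of the two lines. *)
Lemma perspectivity_card (I : incidence) (l l' : iline I) (q : ipoint I) :
  projective_plane I -> ~ inc q l -> ~ inc q l' ->
  [set x | inc x l] #= [set x | inc x l'].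
Proof.
move=> [ul meet _] ql ql'.
have neq x k : inc x k -> ~ inc q k -> x <> q by move=> xk + xq; rewrite -xq.
(* The implication makes the projection total; off [l] its value is the mere default [q]. *)
have /choice[f hf] x : exists y, inc x l -> inc y l' /\ icollinear q x y.
  have [xl|nx] := pselect (inc x l); last by exists q.
  have [k [[xk qk] _]] := ul x q (neq _ _ xl ql).
  have [|y [[yk yl'] _]] := meet k l'; first by move=> kl; apply: ql'; rewrite -kl.
  by exists y => _; split=> //; exists k.
have -> : [set x | inc x l'] = f @` [set x | inc x l]; last first.
  rewrite card_eq_sym; apply: inj_card_eq.
  move=> x1 x2; rewrite !inE /= => x1l x2l e.
  have [[yl' [k1 [qk1 x1k yk1]]] [_ [k2 [qk2 x2k yk2]]]] := (hf _ x1l, hf _ x2l).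
  rewrite -e in yk2; apply: contrapT => x12; apply: ql.
  have k12 := unique_line_same ul (neq _ _ yl' ql') yk1 qk1 yk2 qk2.
  by rewrite -k12 in x2k; rewrite -(unique_line_same ul x12 x1k x2k x1l x2l).
apply/seteqP; split=> [y /= yl'|_ [x /= /hf[? _] <-] //].
have [k [[yk qk] _]] := ul y q (neq _ _ yl' ql').
have [|x [[xk xl] _]] := meet k l; first by move=> kl; apply: ql; rewrite -kl.
exists x => //; have [fl [k' [qk' xk' fk']]] := hf _ xl.
have kk := unique_line_same ul (neq _ _ xl ql) xk qk xk' qk'.
apply: contrapT => fy; apply: ql'; rewrite -kk in fk'.
by rewrite -(unique_line_same ul fy fk' yk fl yl').
Qed.

(** * Desargues' theorem from homogeneous coordinates *)

Section Desargues.

Variables (F : fieldType) (I : incidence).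
Variables (co : ipoint I -> 'rV[F]_3) (fo : iline I -> 'cV[F]_3).
Hypothesis fo_neq0 : forall l, fo l != 0.
Hypothesis co_neq0 : forall x, co x != 0.
Hypothesis co_inj : forall a x y, co x = a *: co y -> x = y.
Hypothesis incE : forall x l, inc x l <-> co x *m fo l = 0.
Hypothesis ul : unique_line I.

(** The vectors of [x] and [y] span at least two dimensions inside the kernel of the line, which has
    dimension at most two. *)
Lemma line_span (x y z : ipoint I) l : x <> y -> inc x l -> inc y l -> inc z l ->
  exists a b, co z = a *: co x + b *: co y.
Proof.
move=> xy /incE/sub_kermxP xl /incE/sub_kermxP yl /incE/sub_kermxP zl.
have rxy : (1 < \rank (co x + co y)%MS)%N.
  rewrite ltnNge; apply/negP => r1; apply: xy; apply/esym.
  have : (co x + co y <= co x)%MS.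
    by rewrite -(geq_leqif (mxrank_leqif_sup (addsmxSl _ _))) rank_rV co_neq0.
  by rewrite addsmx_sub => /andP[_ /sub_rVP[a /co_inj]].
have rk : (\rank (kermx (fo l)) <= 2)%N.
  by rewrite mxrank_ker -mxrank_tr rank_rV -(inj_eq (@trmx_inj _ _ _)) trmxK trmx0 fo_neq0.
have sxy : (co x + co y <= kermx (fo l))%MS by rewrite addsmx_sub xl yl.
have : (kermx (fo l) <= co x + co y)%MS.
  by rewrite -(geq_leqif (mxrank_leqif_sup sxy)) (leq_trans rk).
move=> /(submx_trans zl)/sub_addsmxP[[u v] /= ->].
exists (u 0 0), (v 0 0).
by rewrite {1}[u]mx11_scalar {1}[v]mx11_scalar !mul_scalar_mx.
Qed.

Lemma line_sum (x y z : ipoint I) l : List.NoDup [:: z; x; y] ->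
  inc z l -> inc x l -> inc y l ->
  exists a b, [/\ a != 0, b != 0 & co z = a *: co x + b *: co y].
Proof.
move=> /NoDup3[zx zy xy] zl xl yl.
have [a [b e]] := line_span xy xl yl zl; exists a, b; split=> //.
- by apply/eqP => a0; apply: zy; apply: (@co_inj b); rewrite e a0 scale0r add0r.
- by apply/eqP => b0; apply: zx; apply: (@co_inj a); rewrite e b0 scale0r addr0.
Qed.

(** The vector s a1 - t b1 = t' b2 - s' a2 is a combination along both sides, so it should represent
    their intersection. It is not known to come from a point of [I], hence it is compared with
    [co x] by calculation. *)
Lemma perspective_meet (u : 'rV[F]_3) (a1 a2 b1 b2 x : ipoint I) ab1 ab2 s s' t t' :
  s != 0 -> t != 0 ->
  u = s *: co a1 + s' *: co a2 -> u = t *: co b1 + t' *: co b2 ->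
  a1 <> b1 -> ~ inc a1 ab2 ->
  inc a1 ab1 /\ inc b1 ab1 -> inc a2 ab2 /\ inc b2 ab2 ->
  inc x ab1 /\ inc x ab2 ->
  exists2 c, c != 0 & s *: co a1 - t *: co b1 = c *: co x.
Proof.
move=> s0 t0 ea eb ab na [a11 b11] [/incE a22 /incE b22] [x1 /incE x2].
have [c [d e]] := line_span ab a11 b11 x1.
have ew : (s *: co a1 - t *: co b1) *m fo ab2 = 0.
  have -> : s *: co a1 - t *: co b1 = t' *: co b2 - s' *: co a2.
    apply/eqP; rewrite subr_eq addrAC eq_sym subr_eq -ea addrC -eb //.
  by rewrite mulmxBl -!scalemxAl a22 b22 !scaler0 subrr.
(* The vector of b1 is eliminated. Both terms on the left are killed by [fo ab2], while that of a1
   is not, so the coefficient on the right vanishes. *)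
have e1 : co x + (d / t) *: (s *: co a1 - t *: co b1) = (c / s + d / t) *: (s *: co a1).
  rewrite e scalerBr !scalerA divfK // addrACA subrr addr0 -scalerDl.
  by rewrite mulrDl divfK.
have : (c / s + d / t) *: (s *: co a1) *m fo ab2 = 0.
  by rewrite -e1 mulmxDl -scalemxAl x2 ew scaler0 addr0.
rewrite -!scalemxAl => /eqP; rewrite !scaler_eq0 (negPf s0) /=.
case/orP => [|/eqP /incE //]; rewrite addr_eq0 => /eqP cd.
have ex : co x = (c / s) *: (s *: co a1 - t *: co b1).
  by rewrite e scalerBr !scalerA divfK // cd mulNr divfK // scaleNr opprK.
have c0 : c / s != 0.
  by apply/eqP => c0; have := co_neq0 x; rewrite ex c0 scale0r eqxx.
exists (c / s)^-1; first by rewrite invr_eq0.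
by rewrite ex scalerA mulVf // scale1r.
Qed.

(* With O = A1 + A2 = B1 + B2 = C1 + C2 in homogeneous coordinates, the three
   intersection points are A1 - B1, B1 - C1 and C1 - A1, whose sum is 0. *)
Lemma coordinate_desarguesian : desarguesian I.
Proof.
move=> O a1 b1 c1 a2 b2 c2 la lb lc [Oa Ob Oc] [lab lbc lac] da db dc
  [a1l a2l] [b1l b2l] [c1l c2l] _ _ ab1 ab2 bc1 bc2 ca1 ca2 x y z
  ha1 ha2 hb1 hb2 hc1 hc2 hx hy hz.
have [s [s' [s0 s0' es]]] := line_sum da Oa a1l a2l.
have [t [t' [t0 t0' et]]] := line_sum db Ob b1l b2l.
have [r [r' [r0 r0' er]]] := line_sum dc Oc c1l c2l.
have same := fun x y l l' => @unique_line_same I x y l l' ul.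
(* Different lines through O share no other point; this supplies the nondegeneracy required by
   [perspective_meet]. *)
have sep (u1 v1 u2 v2 : ipoint I) lu lv uv2 : inc O lu -> inc O lv -> lu <> lv ->
    List.NoDup [:: O; u1; u2] -> List.NoDup [:: O; v1; v2] ->
    inc u1 lu -> inc u2 lu -> inc v1 lv -> inc v2 lv ->
    inc u2 uv2 /\ inc v2 uv2 -> u1 <> v1 /\ ~ inc u1 uv2.
  move=> Ou Ov luv /NoDup3[Ou1 Ou2 u12] /NoDup3[Ov1 Ov2 v12] u1l u2l v1l v2l [u2k v2k].
  split; first by move=> uv; rewrite -uv in v1l; apply/luv/(same O u1).
  move=> u1k; have e := same _ _ _ _ u12 u1l u2l u1k u2k.
  by rewrite -e in v2k; apply/luv/(same O v2).
have [ab1' nab] := sep _ _ _ _ _ _ _ Oa Ob lab da db a1l a2l b1l b2l ha2.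
have [bc1' nbc] := sep _ _ _ _ _ _ _ Ob Oc lbc db dc b1l b2l c1l c2l hb2.
have [ca1' nca] := sep _ _ _ _ _ _ _ Oc Oa (nesym lac) dc da c1l c2l a1l a2l hc2.
have [i _ ei] := perspective_meet s0 t0 es et ab1' nab ha1 ha2 hx.
have [j j0 ej] := perspective_meet t0 r0 et er bc1' nbc hb1 hb2 hy.
have [k k0 ek] := perspective_meet r0 s0 er es ca1' nca hc1 hc2 hz.
have sum0 : i *: co x + j *: co y + k *: co z = 0.
  by rewrite -ei -ej -ek [_ + (t *: _ - _)]addrA subrK addrA subrK subrr.
(* If x and y differ, the vanishing sum puts z on their line because [k] is nonzero; otherwise at
   most two points have to be joined. *)
have [xy|xy] := pselect (x = y); last first.
  have [l [[xl yl] _]] := ul xy; exists l; split=> //; apply/incE.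
  move/incE: xl => xl; move/incE: yl => yl.
  move: sum0 => /(congr1 (fun u => u *m fo l)) /eqP.
  rewrite !mulmxDl -!scalemxAl xl yl !scaler0 !add0r mul0mx scaler_eq0 (negPf k0).
  by move=> /eqP.
rewrite -xy in hy *; have [xz|xz] := pselect (x = z).
  by exists ab1; rewrite -xz; case: hx.
by have [l [[xl zl] _]] := ul xz; exists l.
Qed.

End Desargues.

(** * Row vectors of length three *)

Section Row3.

Variable F : fieldType.

Definition row3 (a b c : F) : 'rV[F]_3 := \row_(j < 3) [:: a; b; c]`_j.

Lemma row3_dot a b c a' b' c' :
  row3 a b c *m (row3 a' b' c')^T = 0 <-> a * a' + b * b' + c * c' = 0.
Proof.
have e : (row3 a b c *m (row3 a' b' c')^T) 0 0 = a * a' + b * b' + c * c'.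
  by rewrite mxE !big_ord_recl big_ord0 !mxE /= addr0 addrA.
split=> [h|h]; first by rewrite -e h mxE.
by apply/matrixP => i j; rewrite !ord1 e h mxE.
Qed.

Lemma row3_inj a b c a' b' c' : row3 a b c = row3 a' b' c' ->
  [/\ a = a', b = b' & c = c'].
Proof.
move=> /rowP e; have := e ord0; have := e (lift ord0 ord0).
by have := e (lift ord0 (lift ord0 ord0)); rewrite !mxE.
Qed.

Lemma row3_scale t a b c : t *: row3 a b c = row3 (t * a) (t * b) (t * c).
Proof. by apply/rowP => -[[|[|[|//]]] h]; rewrite !mxE. Qed.

Lemma row3_0 : row3 0 0 0 = 0.
Proof. by apply/rowP => -[[|[|[|//]]] h]; rewrite !mxE. Qed.

End Row3.

(** * Homogeneous coordinates on a full plane *)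

Section FullPlane.

Variables (F : fieldType) (V : lmodType F).
Variables (P : rpoint V -> Prop) (L : rline V -> Prop) (m0 c0 : V).
Local Notation l0 := (RO m0 c0).
Hypothesis P_line : forall q q', q <> q' -> P q -> P q' ->
  exists k, [/\ L k, rinc q k & rinc q' k].
Hypothesis L_meet : forall k k', k <> k' -> L k -> L k' ->
  exists q, [/\ P q, rinc q k & rinc q k'].
Hypothesis L_l0 : L l0.
Hypothesis P_l0 : forall q, rinc q l0 -> P q.
Hypothesis two_off : exists q q',
  [/\ q <> q', P q, P q', ~ rinc q l0 & ~ rinc q' l0].

Definition offset (i : option F) (y : V) : V := y - ev i m0 c0.

Lemma offset_ev i m c : offset i (ev i m c) = ev i (m - m0) (c - c0).
Proof. by rewrite evB. Qed.

Lemma offset0 i y : offset i y = 0 <-> rinc (RP i y) l0.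
Proof. by rewrite /offset /=; split=> [/subr0_eq|->] //; rewrite subrr. Qed.

Lemma P_ordinary_line i y j z : i <> j -> P (RP i y) -> P (RP j z) ->
  exists m c, [/\ L (RO m c), y = ev i m c & z = ev j m c].
Proof.
move=> ij Pi Pj.
have [|[k|m c] [Lk ik jk]] := P_line _ Pi Pj; first by case.
  by case: ij; rewrite ik jk.
by exists m, c.
Qed.

(** The difference from [l0] vanishes where the line meets [l0] and equals [v] at index [i]; two
    values decide. *)
Lemma L_axis m c i v : L (RO m c) -> v <> 0 -> ev i (m - m0) (c - c0) = v ->
  on_axis v (m - m0) /\ on_axis v (c - c0).
Proof.
move=> Lk v0 ei.
have kk : RO m c <> l0 by move=> [em ec]; apply: v0; rewrite -ei em ec evB subrr.
have [q [_ q1 q2]] := L_meet kk Lk L_l0.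
case: q q1 q2 => [//|j z] q1 q2.
have ej : ev j (m - m0) (c - c0) = 0 by rewrite evB -q1 -q2 subrr.
have ij : i <> j by move=> ij; apply: v0; rewrite -ei ij.
apply: (on_axis_ev ij); last by rewrite ej; apply: on_axis0.
by rewrite ei; exists 1; rewrite scale1r.
Qed.

Lemma offset_axis_neq i y j z : i <> j -> P (RP i y) -> P (RP j z) ->
  offset i y <> 0 -> on_axis (offset i y) (offset j z).
Proof.
move=> ij Pi Pj v0; have [m [c [Lk yE zE]]] := P_ordinary_line ij Pi Pj.
have [am ac] := L_axis Lk v0 (esym (etrans (congr1 (offset i) yE) (offset_ev i m c))).
by rewrite zE offset_ev; apply: ev_on_axis.
Qed.

(* If i = j, the lines joining the two points to two different points of l0 meet
   off l0 in a point of another index, to which both points can be compared. *)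
Lemma offset_axis i y j z : P (RP i y) -> P (RP j z) ->
  offset i y <> 0 -> on_axis (offset i y) (offset j z).
Proof.
move=> Pi Pj v0; have [ij|ij] := pselect (i = j); last exact: offset_axis_neq.
rewrite -{j}ij in Pj *.
have [->|/eqP z0] := eqVneq (offset i z) 0; first exact: on_axis0.
have [<-|/eqP yz] := eqVneq y z; first by exists 1; rewrite scale1r.
have [j [k [ij ik jk]]] := three_indices i.
have Pl0 t : P (RP t (ev t m0 c0)) by apply: P_l0.
have [m [c [Lk yE jE]]] := P_ordinary_line ij Pi (Pl0 j).
have [m' [c' [Lk' zE kE]]] := P_ordinary_line ik Pj (Pl0 k).
have [|q [Pw wk wk']] := L_meet _ Lk Lk'.
  by move=> [em ec]; apply: yz; rewrite yE zE em ec.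
case: q Pw wk wk' => [//|t w] Pw wk wk'.
have it : i <> t by move=> it; apply: yz; rewrite yE zE it -wk -wk'.
(* A line other than [l0] meets it at one index only, so the third point, if on [l0], would have
   both indices [j] and [k]. *)
have w_index m1 c1 y1 j1 : y1 = ev i m1 c1 -> offset i y1 <> 0 ->
    ev j1 m0 c0 = ev j1 m1 c1 -> w = ev t m1 c1 -> w = ev t m0 c0 -> t = j1.
  move=> y1E y10 j1E wE w0; apply: contrapT => tj; apply: y10; apply/offset0.
  by have [em ec] := ev_inj tj (etrans (esym wE) w0) (esym j1E); rewrite /= -em -ec.
have w0 : offset t w <> 0.
  move=> /offset0 w0; apply: jk.
  by rewrite -(w_index _ _ _ _ yE v0 jE wk w0) (w_index _ _ _ _ zE z0 kE wk' w0).
apply: on_axis_trans (offset_axis_neq it Pi Pw v0) _.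
exact: on_axis_sym w0 (offset_axis_neq it Pj Pw z0).
Qed.

Lemma plane_axis : exists2 v, v <> 0 & forall i y, P (RP i y) -> on_axis v (offset i y).
Proof.
(* D itself is off [l0] but has no ordinate, so one of two points off [l0] must be chosen. *)
have [i [y [Pi n0]]] : exists i y, P (RP i y) /\ ~ rinc (RP i y) l0.
  have [[|i y] [[|i' y'] [qq Pq Pq' q0 q0']]] := two_off; first by [].
  - by exists i', y'.
  - by exists i, y.
  - by exists i, y.
have v0 : offset i y <> 0 by move=> /offset0.
by exists (offset i y) => // j z Pj; apply: offset_axis.
Qed.

Lemma rinc_meet q q' (k k' : rline V) : k <> k' ->
  rinc q k -> rinc q' k -> rinc q k' -> rinc q' k' -> q = q'.
Proof.
by move=> kk qk qk' rk rk'; apply: contrapT => qq; apply: kk; apply: (rinc_same qq).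
Qed.

(** The line [k] meets [l0] once, and [l0] has at least three points. *)
Lemma l0_points_off k : k <> l0 -> L k -> exists r r',
  [/\ r <> r', rinc r l0, rinc r' l0, ~ rinc r k & ~ rinc r' k].
Proof.
move=> kl Lk; have [q [_ rk r0]] := L_meet kl Lk L_l0.
case: q rk r0 => [//|i y] rk r0.
have [j [j' [ij ij' jj]]] := three_indices i.
have off t : i <> t -> ~ rinc (RP t (ev t m0 c0)) k.
  by move=> it tk; have [] := rinc_meet kl rk tk r0 (erefl : rinc (RP t _) l0).
exists (RP j (ev j m0 c0)), (RP j' (ev j' m0 c0)); split=> //; try exact: off.
by case.
Qed.

(** A point off [l0] is joined to a point of [l0] off [k]; the joining line meets [k] off [l0]. *)
Lemma L_point_off k : k <> l0 -> L k -> exists q, [/\ P q, rinc q k & ~ rinc q l0].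
Proof.
move=> kl Lk; have [s [_ [_ Ps _ s0 _]]] := two_off.
have [sk|sk] := pselect (rinc s k); first by exists s.
have [r [_ [_ r0 _ rk _]]] := l0_points_off kl Lk.
have [|k1 [Lk1 sk1 rk1]] := P_line _ Ps (P_l0 r0); first by move=> sr; apply: s0; rewrite sr.
have [|w [Pw wk1 wk]] := L_meet _ Lk1 Lk; first by move=> kk; apply: sk; rewrite -kk.
exists w; split=> // w0; apply: rk.
have k10 : k1 <> l0 by move=> kk; apply: s0; rewrite -kk.
by rewrite -(rinc_meet k10 wk1 rk1 w0 r0).
Qed.

(** If both given points off [l0] lie on [k], they are joined to two different points of [l0] off
    [k]; the joining lines meet off both [k] and [l0]. The point serves as a center of projection
    from [l0] to [k]. *)
Lemma P_point_off k : k <> l0 -> L k -> exists q, [/\ P q, ~ rinc q k & ~ rinc q l0].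
Proof.
move=> kl Lk; have [s [s' [ss Ps Ps' s0 s0']]] := two_off.
have [sk|sk] := pselect (rinc s k); last by exists s.
have [sk'|sk'] := pselect (rinc s' k); last by exists s'.
have [r [r' [rr r0 r0' rk rk']]] := l0_points_off kl Lk.
have [|k1 [Lk1 sk1 rk1]] := P_line _ Ps (P_l0 r0); first by move=> sr; apply: s0; rewrite sr.
have [|k2 [Lk2 sk2 rk2]] := P_line _ Ps' (P_l0 r0'); first by move=> sr; apply: s0'; rewrite sr.
have k1k : k1 <> k by move=> kk; apply: rk; rewrite -kk.
have k2k : k2 <> k by move=> kk; apply: rk'; rewrite -kk.
have k10 : k1 <> l0 by move=> kk; apply: s0; rewrite -kk.
have k20 : k2 <> l0 by move=> kk; apply: s0'; rewrite -kk.
have [|w [Pw wk1 wk2]] := L_meet _ Lk1 Lk2.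
  by move=> kk; rewrite -kk in sk2; apply/k1k/(rinc_same ss).
exists w; split=> // wk; [apply: ss|apply: rr].
  by rewrite -(rinc_meet k1k wk1 sk1 wk sk) (rinc_meet k2k wk2 sk2 wk sk').
by rewrite -(rinc_meet k10 wk1 rk1 wk r0) (rinc_meet k20 wk2 rk2 wk r0').
Qed.

(** If the offset of a point is s v, then (x, y) becomes (1, x, s) and a point at infinity (0, 1,
    s), while D is (0, 0, 1). A line with m - m0 = a v and c - c0 = b v gets the equation s = a x +
    b. *)
Lemma full_plane_coordinates :
  exists (co : rpoint V -> 'rV[F]_3) (fo : rline V -> 'cV[F]_3),
  [/\ forall q, co q != 0, forall k, fo k != 0,
      forall q k, P q -> L k -> rinc q k <-> co q *m fo k = 0
    & forall q q' a, P q -> P q' -> co q = a *: co q' -> q = q'].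
Proof.
have [v v0 axP] := plane_axis.
(* For [l0] both differences vanish; any other ordinary line of the plane has a point off [l0],
   whose offset is a nonzero multiple of [v]. *)
have axL m c : L (RO m c) -> on_axis v (m - m0) /\ on_axis v (c - c0).
  move=> Lk; have [kl|kl] := pselect (RO m c = l0).
    by case: kl => -> ->; rewrite !subrr; split; apply: on_axis0.
  have [q [Pq qk q0]] := L_point_off kl Lk.
  case: q Pq qk q0 => [//|i y] Pq qk q0.
  have u0 : offset i y <> 0 by move=> /offset0.
  have uE : ev i (m - m0) (c - c0) = offset i y by rewrite -offset_ev -qk.
  by have [am ac] := L_axis Lk u0 uE; split; apply: on_axis_trans (axP _ _ Pq) _.
(* The default 0 off the multiples of [v] carries no information; incidence and injectivity are
   therefore claimed only within [P] and [L]. *)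
have /choice[sc hsc] y : exists s : F, on_axis v y -> y = s *: v.
  by have [[s ->]|ny] := pselect (on_axis v y); [exists s|exists 0].
have vI (a b : F) : a *: v = b *: v -> a = b.
  move=> /eqP; rewrite -subr_eq0 -scalerBl scaler_eq0 subr_eq0.
  by case/orP => /eqP.
pose co (q : rpoint V) := match q with
  | RD => row3 0 0 1
  | RP None y => row3 0 1 (sc (offset None y))
  | RP (Some x) y => row3 1 x (sc (offset (Some x) y))
  end.
pose fo (k : rline V) := (match k with
  | RS None => row3 1 0 0
  | RS (Some x) => row3 (- x) 1 0
  | RO m c => row3 (- sc (c - c0)) (- sc (m - m0)) 1
  end)^T.
have n10 : (1 : F) <> 0 by apply/eqP; rewrite oner_eq0.
have key i y m c : P (RP i y) -> L (RO m c) -> y = ev i m c <->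
    sc (offset i y) *: v = ev i (sc (m - m0) *: v) (sc (c - c0) *: v).
  move=> Pq Lk; have [am ac] := axL _ _ Lk.
  rewrite -(hsc _ (axP _ _ Pq)) -(hsc _ am) -(hsc _ ac) evB.
  by split=> [->|/addIr].
exists co, fo; split.
- by move=> [|[x|] y]; apply/eqP; rewrite -row3_0 => /row3_inj[].
- move=> k; rewrite /fo trmx_eq0; case: k => [[x|]|m c]; apply/eqP;
    by rewrite -row3_0 => /row3_inj[].
- move=> [|[x|] y] [[x'|]|m c] Pq Lk /=; rewrite row3_dot ?(mulr0, mul0r, mulr1, mul1r, add0r, addr0) //.
  + by split=> // [[->]|/eqP]; rewrite ?addNr // addrC subr_eq0 => /eqP ->.
  + apply: iff_trans (key _ _ _ _ Pq Lk) _; rewrite /= scalerA -scalerDl; split=> [/vI ->|e].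
      by ring.
    congr (_ *: v); apply/eqP; rewrite -subr_eq0 -e; apply/eqP; ring.
  + apply: iff_trans (key _ _ _ _ Pq Lk) _; rewrite /=; split=> [/vI ->|e]; first by rewrite addNr.
    by congr (_ *: v); apply/eqP; rewrite -subr_eq0 addrC e.
- have same i y z : P (RP i y) -> P (RP i z) ->
      sc (offset i y) = sc (offset i z) -> y = z.
    move=> Py Pz e; apply: (@addIr _ (- ev i m0 c0)).
    by rewrite -!/(offset _ _) (hsc _ (axP _ _ Py)) e -(hsc _ (axP _ _ Pz)).
  move=> [|[x|] y] [|[x'|] y'] a Pq Pq' //=; rewrite row3_scale => /row3_inj [];
    rewrite ?(mulr0, mulr1).
  + by move=> <- _; rewrite mul0r => /n10.
  + by move=> _ <-; rewrite mul0r => /n10.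
  + by move=> /n10.
  + by move=> <-; rewrite !mul1r => ex es; rewrite -{}ex in Pq' es *; rewrite (same _ _ _ Pq Pq' es).
  + by move=> /n10.
  + by move=> _ /n10.
  + by move=> <-; rewrite mul0r => /n10.
  + by move=> _ <-; rewrite mul1r => es; rewrite (same _ _ _ Pq Pq' es).
Qed.

End FullPlane.

(** No three of the four points are collinear, so at most two of them lie on [l]. *)
Lemma quadrangle_two_off (I : incidence) (l : iline I) : has_quadrangle I ->
  exists x y : ipoint I, [/\ x <> y, ~ inc x l & ~ inc y l].
Proof.
move=> [x [y [z [t [nd nxyz nxyt nxzt nyzt]]]]].
move: nd; rewrite !List.NoDup_cons_iff /= => -[nx [ny [nz _]]].
have [xy xz xt] : [/\ x <> y, x <> z & x <> t].
  by split=> e; apply: nx; rewrite e; tauto.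
have [yz yt] : y <> z /\ y <> t by split=> e; apply: ny; rewrite e; tauto.
have zt : z <> t by move=> e; apply: nz; rewrite e; tauto.
have col u v w : ~ icollinear u v w -> inc u l -> inc v l -> ~ inc w l.
  by move=> h ul vl wl; apply: h; exists l.
have [xl|xl] := pselect (inc x l); have [yl|yl] := pselect (inc y l).
- by exists z, t; split=> //; apply: (col x y).
- have [zl|zl] := pselect (inc z l); last by exists y, z.
  by exists y, t; split=> //; apply: (col x z).
- have [zl|zl] := pselect (inc z l); last by exists x, z.
  by exists x, t; split=> //; apply: (col y z).
- by exists x, y.
Qed.

(** * Order and Desargues property of the full planes *)

Section PlaneTransfer.

Variables (F : fieldType) (V : lmodType F) (I : incidence).
Variables (pt : rpoint V -> ipoint I) (ln : rline V -> iline I).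
Hypothesis pt_inj : injective pt.
Hypothesis pt_surj : forall x, exists q, x = pt q.
Hypothesis ln_surj : forall l, exists k, l = ln k.
Hypothesis inc_pt : forall q l, inc (pt q) (ln l) <-> rinc q l.

Lemma transfer_plane (P : set (ipoint I)) (L : set (iline I)) (n : nat) :
  [set: option F] #= `I_n.+1 -> rectangle_plane (pt RD) P L ->
  desarguesian (subincidence P L) /\ plane_order (subincidence P L) n.
Proof.
move=> cF [pp [l]]; have [ul meet quad] := pp.
have [k ->] := ln_surj l; case: k => [i [_ nD _]|m0 c0 [Ll0 _ lP]].
  by case: nD; apply/inc_pt.
pose S := subincidence P L.
pose sl0 : iline S := exist _ (ln (RO m0 c0)) Ll0.
(* Inverses of [pt] and [ln], by which the plane is read in the explicit rectangle. *)
have [qof hq] := choice pt_surj; have [kof hk] := choice ln_surj.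
have lnI := @ln_inj _ _ _ _ _ inc_pt.
have qofK q : qof (pt q) = q by apply: pt_inj; rewrite -hq.
have kofK k : kof (ln k) = k by apply: lnI; rewrite -hk.
have incS (x : ipoint S) (k : iline S) :
    inc x k <-> rinc (qof (sval x)) (kof (sval k)).
  by rewrite -inc_pt -hq -hk.
have P_line q q' : q <> q' -> P (pt q) -> P (pt q') ->
    exists k, [/\ L (ln k), rinc q k & rinc q' k].
  move=> qq Pq Pq'.
  have [|[k Lk] [[/incS qk /incS qk'] _]] := ul (exist _ _ Pq) (exist _ _ Pq').
    by move=> /(congr1 sval)/pt_inj.
  by exists (kof k); move: qk qk'; rewrite /= !qofK -hk.
have L_meet k k' : k <> k' -> L (ln k) -> L (ln k') ->
    exists q, [/\ P (pt q), rinc q k & rinc q k'].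
  move=> kk Lk Lk'.
  have [|[x Px] [[/incS xk /incS xk'] _]] := meet (exist _ _ Lk) (exist _ _ Lk').
    by move=> /(congr1 sval)/lnI.
  by exists (qof x); move: xk xk'; rewrite /= !kofK -hq.
have P_l0 q : rinc q (RO m0 c0) -> P (pt q) by move=> /inc_pt /lP.
have two_off : exists q q', [/\ q <> q', P (pt q), P (pt q'),
    ~ rinc q (RO m0 c0) & ~ rinc q' (RO m0 c0)].
  have [[x Px] [[y Py] [xy]]] := quadrangle_two_off sl0 quad.
  rewrite !incS /= kofK => x0 y0.
  exists (qof x), (qof y); rewrite -!hq; split=> // e; apply: xy.
  by apply: eq_exist; rewrite (hq x) (hq y) e.
split.
  have [co [fo [co0 fo0 coE coI]]] :=
    full_plane_coordinates P_line L_meet Ll0 P_l0 two_off.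
  apply: (@coordinate_desarguesian _ S (fun x => co (qof (sval x)))
    (fun k => fo (kof (sval k)))) => //.
  - move=> a [x Px] [y Py] /= /coI e; apply: eq_exist.
    by rewrite (hq x) (hq y) e // -hq.
  - by move=> [x Px] [k Lk]; rewrite incS /=; apply: coE; rewrite -?hq -?hk.
(* All points of the full line belong to the plane, one for each element of [option F]. *)
have c0E : [set x | inc x sl0] #= `I_n.+1.
  rewrite -(card_eqr cF).
  pose h i : ipoint S := exist _ (pt (RP i (ev i m0 c0))) (P_l0 (RP i _) erefl).
  have -> : [set x | inc x sl0] = h @` [set: option F].
    apply/seteqP; split=> [[x Px] /= x0|_ [i _ <-] /=]; last exact/inc_pt.
    rewrite (hq x) inc_pt in x0; case e: (qof x) x0 => [//|i y] /= yE.
    by exists i => //; apply: eq_exist; rewrite (hq x) e yE.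
  apply: inj_card_eq; apply: in2W => i j /(congr1 sval)/pt_inj [].
  by [].
move=> [l' Ll'].
have [e|ne] := pselect (l' = ln (RO m0 c0)).
  by rewrite (_ : exist _ _ _ = sl0) //; apply: eq_exist.
(* The count is carried to [l'] by projection from a point off both lines. *)
have [||q [Pq q1 q0]] := @P_point_off _ _ _ _ _ _ P_line L_meet Ll0 P_l0 two_off (kof l').
- by move=> kl; apply: ne; rewrite (hk l') kl.
- by rewrite -hk.
rewrite -(card_eqr c0E); apply: (@perspectivity_card S _ _ (exist _ _ Pq)) => //.
- by rewrite incS /= qofK.
- by rewrite incS /= qofK kofK.
Qed.

End PlaneTransfer.

(** * The harmonic closure as a rectangle *)

Theorem theorem5p1 (p : nat) (hp : prime p) (V : lmodType 'F_p)
    (hV : exists v : V, v <> 0%R)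
    (E : Type) (M : matroid E) (hM : harmonic_matroid M)
    (phi : Lpoint V -> E) (hphi : matroid_embedding (LpV V) M phi) :
  let R := set_incidence (harmonic_closure (embedded_points M phi)) in
  exists D : ipoint R,
    [/\ projective_rectangle D,
        rectangle_order D 'I_p V
      & forall (P : set (ipoint R)) (L : set (iline R)),
          rectangle_plane D P L ->
          desarguesian (subincidence P L) /\ plane_order (subincidence P L) p].
Proof.
move=> R; case: hV => v0 v0_neq0.
have [J [onJ cJ XJ eJ]] := pencil_rows v0_neq0 hM hphi.
pose D := epoint hphi LD.
have mO := oline_mline hphi; have DO := @oline_D _ _ _ _ _ hphi.
pose pq := rpt D J; pose lk := rln D J (oline hphi).
have pqI : injective pq := rpt_inj v0_neq0 onJ DO.
have pq_on q l : on (pq q) (lk l) <-> rinc q l := rpt_on v0_neq0 mO onJ DO cJ q l.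
(* The rows were built inside the closure, and the rectangle is closed under harmonic
   conjugation. *)
have XE : harmonic_closure (embedded_points M phi) = range pq.
  apply: (harmonic_closure_rpt v0_neq0 mO onJ DO cJ) => [x [u xu]|[|i y]].
  - have -> : x = epoint hphi u by apply: mpoint_eq.
    have [->|/eJ[i [y ->]]] := pselect (u = LD); first by exists RD.
    by exists (RP i y).
  - exact: epoint_closure.
  - exact: XJ.
have Xpq q : harmonic_closure (embedded_points M phi) (pq q) by rewrite XE; exists q.
have Xr x : harmonic_closure (embedded_points M phi) x -> exists q, pq q = x.
  by rewrite XE => -[q _]; exists q.
pose pt q : ipoint R := exist _ (pq q) (Xpq q).
pose lset l := [set z | harmonic_closure (embedded_points M phi) z /\ on z (lk l)].
have hl l : exists x y, [/\ harmonic_closure (embedded_points M phi) x,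
    harmonic_closure (embedded_points M phi) y, x <> y &
    lset l = [set z | harmonic_closure (embedded_points M phi) z /\ pset z `<=` span2 x y]].
  have [q [q' [qq ql ql']]] := rline_two_points l.
  exists (pq q), (pq q'); split=> //; first by move/pqI.
  by rewrite (rln_span2 v0_neq0 mO onJ DO cJ qq ql ql').
pose ln l : iline R := exist _ (lset l) (hl l).
have ptI : injective pt by move=> q q' /(congr1 sval)/pqI.
have ptS x : exists q, x = pt q.
  by case: x => x Xx; have [q qx] := Xr x Xx; exists q; apply: eq_exist.
have inc_pt q l : inc (pt q) (ln l) <-> rinc q l.
  apply: iff_trans (pq_on q l); split=> [[_ h]|h]; first exact: h.
  by split; [exact: Xpq|exact: h].
have lnS l : exists k, l = ln k.
  case: l => l [x [y [Xx Xy xy lE]]].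
  have [[q qx] [q' qy]] := (Xr _ Xx, Xr _ Xy).
  have qq : q <> q' by move=> qq; apply: xy; rewrite -qx -qy qq.
  have [k [qk qk']] := rline_through qq; exists k; apply: eq_exist.
  by rewrite lE -qx -qy (rln_span2 v0_neq0 mO onJ DO cJ qq qk qk').
have cF : [set: option 'F_p] #= `I_p.+1.
  by have := card_finType (option 'F_p); rewrite card_option card_Fp.
exists (pt RD); split.
- exact: (transfer_rectangle v0_neq0 ptI ptS lnS inc_pt).
- apply: (transfer_order ptI ptS lnS inc_pt); rewrite (card_eql cF) card_eq_sym.
  by have := card_finType (option 'I_p); rewrite card_option card_ord.
- by move=> P L; apply: (transfer_plane ptI ptS lnS inc_pt).
Qed.
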